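(* Let $1<p<\infty$, $q,Q,t\in\mathbb{R}$ and $s>-1$. Suppose that either (i) $-(N+1)<s+t<-1$ and $s+t+\frac{Q-q}{p}\le-1$, or (ii) $s+t>-1$ and $Q<q$. Then there is no weight $\omega$ on $\mathbb{B}$ such that $P_{s,t}$ is well defined and continuous from $L^p(\omega\,d\mu_q)$ to $L^p(\omega\,d\mu_Q)$.
   Context: $N\ge1$; $\langle z,w\rangle=\sum_{j=1}^N z_j\overline{w_j}$, $|z|=\sqrt{\langle z,z\rangle}$ on $\mathbb{C}^N$; $\mathbb{B}$ is the open unit ball of $\mathbb{C}^N$; $\mu$ is normalized Lebesgue measure on $\mathbb{B}$; for $c\in\mathbb{R}$, $d\mu_c(z)=(1-|z|^2)^c d\mu(z)$. A weight is a positive (a.e.) locally integrable function on $\mathbb{B}$. For $s+t>-(N+1)$ the operator is $P_{s,t}f(z)=(1-|z|^2)^t\int_{\mathbb{B}}\frac{f(w)(1-|w|^2)^{s}}{(1-\langle z,w\rangle)^{N+1+s+t}}\,d\mu(w)$. ''Well defined and continuous'' means that for every $f\in L^p(\omega\,d\mu_q)$ the integral converges absolutely for almost every $z\in\mathbb{B}$, and $\|P_{s,t}f\|_{L^p(\omega\,d\mu_Q)}\le C\|f\|_{L^p(\omega\,d\mu_q)}$ with $C$ independent of $f$. *)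

(* Defs.v *)
From HB Require Import structures.
From mathcomp Require Import all_boot all_order all_algebra.
From mathcomp Require Import all_classical all_reals all_analysis.
From mathcomp Require Import complex.

Set Implicit Arguments.
Unset Strict Implicit.
Unset Printing Implicit Defensive.

Import Order.TTheory GRing.Theory Num.Theory numFieldNormedType.Exports.
Import ComplexField.Normc.

Local Open Scope classical_set_scope.
Local Open Scope ring_scope.

(* The usual topology of C: R[i] is normed by its modulus. *)
HB.instance Definition _ (R : realType) := NormedModule.copy R[i] R[i]^o.

(* A set of complex numbers is measurable when the corresponding subset of R * R
   is Borel. *)
Section measurable_complex.
Variable R : realType.

Definition complex_of_pair (p : measurableTypeR R * measurableTypeR R) : R[i] :=
  Complex p.1 p.2.

Definition complex_measurable : set (set R[i]) :=
  [set A | measurable (complex_of_pair @^-1` A)].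

Let complex_measurable0 : complex_measurable set0.
Proof. by rewrite /complex_measurable /= preimage_set0; exact: measurable0. Qed.

Let complex_measurableC A : complex_measurable A -> complex_measurable (~` A).
Proof.
by rewrite /complex_measurable /= preimage_setC => mA; exact: measurableC.
Qed.

Let complex_measurable_bigcup (F : (set R[i])^nat) :
  (forall i, complex_measurable (F i)) ->
  complex_measurable (\bigcup_i (F i)).
Proof.
rewrite /complex_measurable /= => mF; rewrite preimage_bigcup.
exact: bigcup_measurable.
Qed.

HB.instance Definition _ := @isMeasurable.Build default_measure_display
  R[i] complex_measurable complex_measurable0 complex_measurableC
  complex_measurable_bigcup.

End measurable_complex.

Section measurable_matrix.
Context {d : measure_display} {T : measurableType d}.
Variables m n : nat.

Definition matrix_measurable : set (set 'M[T]_(m, n)) :=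
  <<s [set A | exists i j (B : set T),
         measurable B /\ A = (fun M : 'M[T]_(m, n) => M i j) @^-1` B] >>.

Let matrix_measurable0 : matrix_measurable set0.
Proof. exact: sigma_algebra0. Qed.

Let matrix_measurableC A : matrix_measurable A -> matrix_measurable (~` A).
Proof. exact: sigma_algebraC. Qed.

Let matrix_measurable_bigcup (F : (set 'M[T]_(m, n))^nat) :
  (forall i, matrix_measurable (F i)) -> matrix_measurable (\bigcup_i (F i)).
Proof. exact: sigma_algebra_bigcup. Qed.

HB.instance Definition _ := @isMeasurable.Build (measure_tuple_display d)
  'M[T]_(m, n) matrix_measurable matrix_measurable0 matrix_measurableC
  matrix_measurable_bigcup.

End measurable_matrix.

Lemma measurable_mx_entry d (T : measurableType d) m n i j :
  measurable_fun setT (fun M : 'M[T]_(m, n) => M i j).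
Proof.
move=> _ B mB; rewrite setTI; apply: sub_sigma_algebra.
by exists i, j, B.
Qed.

Lemma measurable_fun_mx d (T : measurableType d) d' (U : measurableType d')
    m n (f : U -> 'M[T]_(m, n)) :
  (forall i j, measurable_fun setT (fun u => f u i j)) -> measurable_fun setT f.
Proof.
move=> mf.
apply: (@measurability _ _ _ _ _ _ [set A | exists i j (B : set T),
         measurable B /\ A = (fun M : 'M[T]_(m, n) => M i j) @^-1` B]) => //.
move=> _ [_ [i [j [B [mB ->]]]] <-].
exact: mf.
Qed.

(* Image of a sigma-finite measure under f, where f has a measurable left
   inverse g; the latter makes the image sigma-finite. *)
Section image_measure.
Local Open Scope ereal_scope.
Context d d' (T : measurableType d) (U : measurableType d') (R : realType).
Variables (m : {sigma_finite_measure set T -> \bar R}) (f : T -> U) (g : U -> T).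
Hypotheses (mf : measurable_fun setT f) (mg : measurable_fun setT g).
Hypothesis fK : cancel f g.

Definition image_measure of measurable_fun setT f & measurable_fun setT g
  & cancel f g : set U -> \bar R := pushforward m f.

Local Notation image := (image_measure mf mg fK).

Let image0 : image set0 = 0.
Proof. exact: (measure0 (pushforward m f)). Qed.

Let image_ge0 A : 0 <= image A.
Proof. exact: (measure_ge0 (pushforward m f)). Qed.

Let image_sigma_additive : semi_sigma_additive image.
Proof. exact: (@measure_semi_sigma_additive _ _ _ (pushforward m f)). Qed.

HB.instance Definition _ := isMeasure.Build _ _ _ image
  image0 image_ge0 image_sigma_additive.

Let image_sigma_finite : sigma_finite setT image.
Proof.
have [F TF mF] := sigma_finiteT m.
exists (fun k => g @^-1` F k); first by rewrite -preimage_bigcup -TF.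
move=> k; have [mFk Fk] := mF k; split.
  by rewrite -[X in measurable X]setTI; exact: mg.
rewrite /image_measure /pushforward (_ : f @^-1` _ = F k)//.
by apply/seteqP; split => x /=; rewrite fK.
Qed.

HB.instance Definition _ := Measure_isSigmaFinite.Build _ _ _ image
  image_sigma_finite.

End image_measure.

(* The library declares the sigma-finite structure of m1 \x m2 only for
   sub-probabilities m1 and m2. *)
Section sigma_finite_product.
Local Open Scope ereal_scope.
Context d d' (T : measurableType d) (U : measurableType d') (R : realType).
Variables (m1 : {sigma_finite_measure set T -> \bar R}).
Variables (m2 : {sigma_finite_measure set U -> \bar R}).

Definition product_measure : set (T * U) -> \bar R := m1 \x m2.

HB.instance Definition _ := Measure.on product_measure.

Let product_measure_sigma_finite : sigma_finite setT product_measure.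
Proof.
have /sigma_finiteP[F [TF ndF Foo]] := sigma_finiteT m1.
have /sigma_finiteP[G [TG ndG Goo]] := sigma_finiteT m2.
exists (fun n => F n `*` G n).
  rewrite -setXTT TF TG predeqE => -[x y]; split.
    move=> [/= [n _ Fnx] [k _ Gky]]; exists (maxn n k) => //; split.
    - by move: x Fnx; exact/subsetPset/ndF/leq_maxl.
    - by move: y Gky; exact/subsetPset/ndG/leq_maxr.
  by move=> [n _ []/= ? ?]; split; exists n.
move=> k; have [mFk Fk] := Foo k; have [mGk Gk] := Goo k.
split; first exact: measurableX.
by rewrite /product_measure product_measure1E// lte_mul_pinfty// ge0_fin_numE.
Qed.

HB.instance Definition _ := Measure_isSigmaFinite.Build _ _ _ product_measure
  product_measure_sigma_finite.

End sigma_finite_product.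

Section lebesgue_complex.
Variable R : realType.

Definition pair_of_complex (z : R[i]) : measurableTypeR R * measurableTypeR R :=
  (complex.Re z, complex.Im z).

Lemma complex_of_pairK : cancel (@complex_of_pair R) pair_of_complex.
Proof. by case. Qed.

Lemma measurable_complex_of_pair : measurable_fun setT (@complex_of_pair R).
Proof. by move=> _ A mA; rewrite setTI. Qed.

Lemma measurable_pair_of_complex : measurable_fun setT pair_of_complex.
Proof.
move=> _ A mA; rewrite setTI /measurable /= /complex_measurable /=.
by rewrite (_ : _ @^-1` _ = A)//; apply/seteqP; split=> -[].
Qed.

Definition lebesgue_complex : {sigma_finite_measure set R[i] -> \bar R} :=
  image_measure (product_measure (@lebesgue_measure R) (@lebesgue_measure R))
    measurable_complex_of_pair measurable_pair_of_complex complex_of_pairK.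

End lebesgue_complex.

(* Lebesgue measure on C^N, by C^(N+1) = C * C^N; C^0 is a point of mass 1. *)
Section lebesgue_Cn.
Variable R : realType.

Definition Ccons n (p : R[i] * 'rV[R[i]]_n) : 'rV[R[i]]_n.+1 :=
  row_mx (const_mx p.1 : 'rV_1) p.2.

Definition Cuncons n (z : 'rV[R[i]]_n.+1) : R[i] * 'rV[R[i]]_n :=
  (z 0 0, rsubmx (z : 'rV_(1 + n))).

Lemma CconsK n : cancel (@Ccons n) (@Cuncons n).
Proof.
move=> [x z]; rewrite /Cuncons /Ccons row_mxKr /=; congr (_, _).
by rewrite mxE; case: splitP => // j _; rewrite mxE.
Qed.

Lemma measurable_Ccons n : measurable_fun setT (@Ccons n).
Proof.
apply: measurable_fun_mx => i j; rewrite /Ccons.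
have -> : (fun u : R[i] * 'rV[R[i]]_n =>
    row_mx (const_mx u.1 : 'rV_1) u.2 i j) =
  match fintype.split (j : 'I_(1 + n)) with
  | inl _ => fst | inr k => (fun u => u.2 i k) end.
  by apply/funext => u; rewrite mxE; case: fintype.split => k //; rewrite mxE.
case: fintype.split => k; first exact: measurable_fst.
apply: (measurableT_comp (f := fun z : 'rV[R[i]]_n => z i k)) => //.
exact: measurable_mx_entry.
Qed.

Lemma measurable_Cuncons n : measurable_fun setT (@Cuncons n).
Proof.
apply/measurable_fun_pairP; split.
  exact: measurable_mx_entry.
apply: measurable_fun_mx => i j.
under eq_fun do rewrite /Cuncons /= mxE.
exact: measurable_mx_entry.
Qed.

Fixpoint lebesgue_Cn n : {sigma_finite_measure set 'rV[R[i]]_n -> \bar R} :=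
  if n is n'.+1 then
    image_measure (product_measure (lebesgue_complex R) (lebesgue_Cn n'))
      (@measurable_Ccons n') (@measurable_Cuncons n') (@CconsK n')
  else \d_(0 : 'rV[R[i]]_0).

End lebesgue_Cn.

Section ball_spaces.
Variables (R : realType) (N : nat).
Local Notation CN := 'rV[R[i]]_N.
Implicit Types (z w : CN) (omega : CN -> R) (f : CN -> R[i]).

Definition inner z w : R[i] := \sum_(j < N) z 0 j * (w 0 j)^*.

Definition enorm z : R := Num.sqrt (complex.Re (inner z z)).

Definition unit_ball : set CN := [set z | enorm z < 1].

Lemma inv_volume_ge0 : 0 <= (fine (lebesgue_Cn R N unit_ball))^-1.
Proof. by rewrite invr_ge0 fine_ge0. Qed.

(* Lebesgue measure normalized so that the unit ball has measure 1; it is only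
   ever integrated over subsets of the unit ball. *)
Definition muB : {measure set CN -> \bar R} :=
  mscale (NngNum inv_volume_ge0) (lebesgue_Cn R N).

Definition weight omega : Prop :=
  [/\ measurable_fun unit_ball omega,
      {ae muB, forall z, unit_ball z -> 0 < omega z} &
      forall K, K `<=` unit_ball -> compact K ->
        (\int[muB]_(z in K) `|omega z|%:E < +oo)%E].

(* The L^p norm of f with respect to omega dmu_c. *)
Definition Lp_norm omega (p c : R) f : \bar R :=
  ((\int[muB]_(z in unit_ball)
     (normc (f z) `^ p * omega z * (1 - enorm z ^+ 2) `^ c)%:E) `^ p^-1)%E.

Definition in_Lp omega (p c : R) f : Prop :=
  measurable_fun unit_ball f /\ (Lp_norm omega p c f < +oo)%E.

End ball_spaces.

Section complex_power.
Variable R : realType.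
Implicit Types z : R[i].

(* The principal argument, in ]-pi, pi]. *)
Definition arg z : R :=
  if 0 <= complex.Im z then acos (complex.Re z / normc z)
  else - acos (complex.Re z / normc z).

(* The principal branch of z^a for z != 0. *)
Definition cpow z (a : R) : R[i] :=
  Complex (normc z `^ a * cos (a * arg z)) (normc z `^ a * sin (a * arg z)).

End complex_power.

Section operator.
Variables (R : realType) (N : nat).
Local Notation CN := 'rV[R[i]]_N.
Local Notation muB := (muB R N).
Local Notation ball := (@unit_ball R N).
Implicit Types (z w : CN) (omega : CN -> R) (f F : CN -> R[i]).

(* Absolute convergence of the integral of F over the ball. *)
Definition Cintegrable F : Prop :=
  measurable_fun ball F /\ (\int[muB]_(w in ball) (normc (F w))%:E < +oo)%E.

Definition Cintegral F : R[i] :=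
  Complex (\int[muB]_(w in ball) complex.Re (F w))
          (\int[muB]_(w in ball) complex.Im (F w)).

Definition P_integrand (s t : R) f z w : R[i] :=
  f w * ((1 - enorm w ^+ 2) `^ s)%:C%C
    / cpow (1 - inner z w) (N%:R + 1 + s + t).

Definition Pop (s t : R) f z : R[i] :=
  ((1 - enorm z ^+ 2) `^ t)%:C%C * Cintegral (P_integrand s t f z).

(* Measurability of Pop s t f is not required: where the integral converges
   absolutely it follows from Tonelli's theorem. *)
Definition well_defined_continuous (s t p q Q : R) omega : Prop :=
  (forall f, in_Lp omega p q f ->
     {ae muB, forall z, ball z -> Cintegrable (P_integrand s t f z)}) /\
  exists C : R, forall f, in_Lp omega p q f ->
     (Lp_norm omega p Q (Pop s t f) <= C%:E * Lp_norm omega p q f)%E.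

End operator.

(* Main.v *)
Require Import Defs.
From mathcomp Require Import all_boot all_order all_algebra.
From mathcomp Require Import all_classical all_reals all_analysis.
From mathcomp Require Import complex.
From mathcomp Require Import measurable_realfun measurable_fun_approximation.
From mathcomp Require Import ring lra.
Import Order.TTheory GRing.Theory Num.Theory.
Import numFieldNormedType.Exports ComplexField.Normc.
Local Open Scope ring_scope.
Local Open Scope classical_set_scope.

Set Implicit Arguments.
Unset Strict Implicit.
Unset Printing Implicit Defensive.

(* Let k = N + 1 + s + t and h(z) = 1 - |z|^2. Continuity is tested on functions
   f >= 0 for which the kernel has real part bounded below, so that |P f| is at
   least a constant times h^t times the integral of f h^s.

   Case (ii). On an anisotropic box B of Bergman size at distance h0 from the
   boundary, the kernel is comparable to h0^(-k) and mu(B) to h0^(N+1), so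
   f = 1_B gives h0^Q omega(B) <= C h0^q omega(B), absurd as h0 tends to 0.

   Case (i). Near the center the kernel is bounded below. Taking f supported
   there shows that omega h^(tp+Q) is integrable; evaluating P f there, with f
   (truncated) extremal for Hoelder's inequality, shows that
   psi = omega^(-1/(p-1)) h^((sp-q)/(p-1)) is integrable. By Young's inequality
   h^(s+t+(Q-q)/p) <= omega h^(tp+Q) + psi, so h^(-1) would be integrable on the
   ball, which it is not. *)

(** * Comparison of integrals of functions that may fail to be measurable *)

Section lower_integral.
Local Open Scope ereal_scope.
Context d (T : measurableType d) (R : realType).
Variable mu : {measure set T -> \bar R}.
Implicit Types (D : set T) (f g : T -> \bar R).

(* The integral of a nonnegative function is a supremum over the simple
   functions below it, so measurability plays no role. *)
Lemma le_integral_nonmeasurable D f g :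
  (forall x, D x -> 0 <= f x) -> (forall x, D x -> f x <= g x) ->
  \int[mu]_(x in D) f x <= \int[mu]_(x in D) g x.
Proof.
move=> f0 fg; have g0 x : D x -> 0 <= g x.
  by move=> Dx; exact: le_trans (f0 x Dx) (fg x Dx).
rewrite !ge0_integralE//; apply: ge_ereal_sup => _ [h /= hf <-].
apply: ereal_sup_ubound; exists h => //= x; apply: (le_trans (hf x)).
by rewrite /patch; case: ifPn => // /set_mem; exact: fg.
Qed.

(** The negative part of [g] on [D] lives on the null set [Z], hence is at most [+oo] times the
    indicator of [Z], whose integral is zero. This is applied with [g] built from [|P f|^p omega],
    which is controlled only almost everywhere. *)
Lemma le_integral_off_null D Z f g :
  measurable D -> measurable Z -> mu Z = 0 -> measurable_fun D f ->
  (forall x, D x -> 0 <= f x) -> (forall x, D x -> ~ Z x -> f x <= g x) ->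
  \int[mu]_(x in D) f x <= \int[mu]_(x in D) g x.
Proof.
move=> mD mZ Z0 mf f0 fg.
have gN : \int[mu]_(x in D) g ^\- x = 0.
  apply/eqP; rewrite eq_le integral_ge0 ?andbT; last first.
    by move=> x _; exact: funeneg_ge0.
  rewrite [leRHS](_ : 0 = \int[mu]_(x in D) (+oo * (\1_Z x)%:E)); last first.
    rewrite ge0_integralZl//; last first.
      by apply/measurable_EFinP; exact: measurable_indic.
    rewrite integral_indic// [X in _ * X](_ : _ = 0) ?mule0//.
    by apply: (subset_measure0 _ mZ _ Z0); [exact: measurableI|move=> x []].
  apply: le_integral_nonmeasurable => x Dx; first exact: funeneg_ge0.
  rewrite indicE; case: (boolP (x \in Z)) => [_|/negP Zx].
    by rewrite mule1 leey.
  rewrite mule0 funenegE ge_max lexx andbT leeNl oppe0.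
  by apply: (le_trans (f0 x Dx)); apply: fg => // /mem_set.
rewrite [leRHS]integralE gN sube0 (ge0_negligible_integral mZ)//.
apply: (@le_trans _ _ (\int[mu]_(x in D `\` Z) g ^\+ x)).
  apply: le_integral_nonmeasurable => x [Dx Zx]; first exact: f0.
  by rewrite funeposE le_max fg.
rewrite integral_mkcond [leRHS]integral_mkcond.
apply: le_integral_nonmeasurable => x _.
  by apply: erestrict_ge0 => y _; exact: funepos_ge0.
rewrite /patch; case: ifPn => [/set_mem[Dx _]|_]; first by rewrite mem_set.
by case: ifPn => // _; exact: funepos_ge0.
Qed.

End lower_integral.

Lemma integral_supported d (T : measurableType d) (R : realType)
    (mu : {measure set T -> \bar R}) (D B : set T) (f : T -> \bar R) :
  B `<=` D -> (forall x, D x -> ~ B x -> f x = 0%E) ->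
  (\int[mu]_(x in D) f x = \int[mu]_(x in B) f x)%E.
Proof.
move=> BD f0; rewrite integral_mkcond [RHS]integral_mkcond.
apply: eq_integral => x _; rewrite /patch.
have [/set_mem Bx|Bx] := boolP (x \in B); first by rewrite mem_set//; exact: BD.
case: ifPn => // /set_mem Dx; apply: f0 => // /mem_set.
exact/negP.
Qed.

Lemma integral_eq_pinfty d (T : measurableType d) (R : realType)
    (mu : {measure set T -> \bar R}) (E : set T) (f : T -> \bar R) :
  measurable E -> (0 < mu E)%E -> (forall x, 0 <= f x)%E ->
  (forall x, E x -> f x = +oo%E) -> (\int[mu]_x f x = +oo)%E.
Proof.
move=> mE muE f0 fE; apply/eqP; rewrite eq_le leey /=.
rewrite -(gt0_mulye muE) -integral_cst// integral_mkcond.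
apply: le_integral_nonmeasurable => x _.
  by apply: erestrict_ge0 => y _; exact: leey.
by rewrite /patch; case: ifPn => // /set_mem /fE ->.
Qed.

(** * Volume of boxes in C^n *)

Section box_volume.
Variable R : realType.

Lemma measurable_Re : measurable_fun setT (@complex.Re R : R[i] -> R).
Proof.
apply: (measurableT_comp (f := fst) (g := @pair_of_complex R)) => //.
exact: measurable_pair_of_complex.
Qed.

Lemma measurable_Im : measurable_fun setT (@complex.Im R : R[i] -> R).
Proof.
apply: (measurableT_comp (f := snd) (g := @pair_of_complex R)) => //.
exact: measurable_pair_of_complex.
Qed.

Lemma measurable_real_complex :
  measurable_fun setT (fun x : R => (x%:C)%C : R[i]).
Proof.
apply: (measurableT_comp (f := @complex_of_pair R)
  (g := fun x : measurableTypeR R => (x, 0) : measurableTypeR R * _)).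
  exact: measurable_complex_of_pair.
exact: measurable_fun_pair.
Qed.

(** Squares rather than discs, so that volumes are products of interval lengths. Real centers are
    enough: the boxes below are centered at 0 or at (sqrt (1 - h), 0, ..., 0). *)
Definition square (c d : R) : set R[i] :=
  [set x | `|complex.Re x - c| <= d /\ `|complex.Im x| <= d].

Definition box n (c d : 'I_n -> R) : set 'rV[R[i]]_n :=
  [set z | forall j, square (c j) (d j) (z 0 j)].

Lemma square_preimage c d :
  @complex_of_pair R @^-1` square c d = `[c - d, c + d] `*` `[- d, d].
Proof.
apply/seteqP; split=> -[x y] /=; rewrite /square /= !in_itv/= !ler_norml.
  by move=> [/andP[? ?] ?]; split=> //; lra.
by move=> [/andP[? ?] ?]; split=> //; lra.
Qed.

Lemma measurable_square c d : measurable (square c d).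
Proof.
by rewrite /measurable /= /complex_measurable /= square_preimage;
  exact: measurableX.
Qed.

Lemma lebesgue_square c d : 0 <= d ->
  lebesgue_complex R (square c d) = ((2 * d) ^+ 2)%:E.
Proof.
move=> d0; rewrite /= /image_measure /pushforward square_preimage.
rewrite /product_measure product_measure1E//= !lebesgue_measure_itv/= !lte_fin.
case: ifPn => [|cd]; last first.
  by rewrite mul0e (_ : d = 0) ?mulr0 ?expr0n//; lra.
move=> _; case: ifPn => [_|dd]; last first.
  by rewrite mule0 (_ : d = 0) ?mulr0 ?expr0n//; lra.
by rewrite -!EFinD -EFinM; congr (_%:E); ring.
Qed.

Lemma measurable_box n (c d : 'I_n -> R) : measurable (box c d).
Proof.
have -> : box c d = \bigcap_(j in [set: 'I_n])
    ((fun z : 'rV[R[i]]_n => z 0 j) @^-1` square (c j) (d j)).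
  apply/seteqP; split=> [z zb j _|z zb j]; [exact: zb|exact: (zb j)].
apply: fin_bigcap_measurable => // j _; rewrite -[X in measurable X]setTI.
by apply: measurable_mx_entry => //; exact: measurable_square.
Qed.

Lemma box_preimage n (c d : 'I_n.+1 -> R) :
  @Ccons R n @^-1` box c d =
  square (c ord0) (d ord0) `*` box (c \o lift ord0) (d \o lift ord0).
Proof.
have Ccons0 u : @Ccons R n u 0 ord0 = u.1.
  by rewrite mxE; case: splitP => // j _; rewrite mxE.
have CconsS u j : @Ccons R n u 0 (lift ord0 j) = u.2 0 j.
  by rewrite -rshift1 (row_mxEr (const_mx u.1 : 'rV_1)).
apply/seteqP; split=> u /=.
  move=> ub; split; first by have := ub ord0; rewrite Ccons0.
  by move=> j /=; have := ub (lift ord0 j); rewrite CconsS.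
move=> [u1 u2] j; case: (unliftP ord0 j) => [k ->|->].
  by rewrite CconsS; exact: u2.
by rewrite Ccons0.
Qed.

Lemma lebesgue_box n (c d : 'I_n -> R) : (forall j, 0 <= d j) ->
  lebesgue_Cn R n (box c d) = (\prod_j (2 * d j) ^+ 2)%:E.
Proof.
elim: n c d => [|n IH] c d d0.
  by rewrite big_ord0 /= diracE mem_set// => -[].
transitivity (lebesgue_complex R (square (c ord0) (d ord0)) *
    lebesgue_Cn R n (box (c \o lift ord0) (d \o lift ord0)))%E.
  rewrite /= /image_measure /pushforward box_preimage.
  by apply: product_measure1E; [exact: measurable_square|exact: measurable_box].
by rewrite lebesgue_square// IH ?big_ord_recl -?EFinM// => j; exact: d0.
Qed.

End box_volume.

(** * The defining function of the ball, and the ball's volume *)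

Section ball.
Variables (R : realType) (N : nat).
Implicit Types z w : 'rV[R[i]]_N.

(** This is the h(z) of the overview: positive exactly on the ball, and comparable there to the
    distance to the sphere. *)
Definition gap z : R := 1 - enorm z ^+ 2.

Lemma normc_sqr (x : R[i]) : normc x ^+ 2 = complex.Re x ^+ 2 + complex.Im x ^+ 2.
Proof. by case: x => a b /=; rewrite sqr_sqrtr// addr_ge0 ?sqr_ge0. Qed.

Lemma normc_ge0 (x : R[i]) : 0 <= normc x.
Proof. by case: x => a b; exact: sqrtr_ge0. Qed.

Lemma normc_ge_absRe (x : R[i]) : `|complex.Re x| <= normc x.
Proof.
by case: x => a b /=; rewrite -sqrtr_sqr ler_wsqrtr// lerDl sqr_ge0.
Qed.

Lemma normc_ge_absIm (x : R[i]) : `|complex.Im x| <= normc x.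
Proof.
by case: x => a b /=; rewrite -sqrtr_sqr ler_wsqrtr// lerDr sqr_ge0.
Qed.

Lemma Re_sum (I : finType) (F : I -> R[i]) :
  complex.Re (\sum_i F i) = \sum_i complex.Re (F i).
Proof. by apply: big_morph => // -[a b] [c d]. Qed.

Lemma Re_innerzz z : complex.Re (inner z z) = \sum_j normc (z 0 j) ^+ 2.
Proof.
rewrite /inner Re_sum; apply: eq_bigr => j _; rewrite normc_sqr.
by case: (z 0 j) => a b /=; ring.
Qed.

Lemma enorm_sqr z : enorm z ^+ 2 = \sum_j normc (z 0 j) ^+ 2.
Proof. by rewrite sqr_sqrtr Re_innerzz// sumr_ge0// => j _; exact: sqr_ge0. Qed.

Lemma gapE z : gap z = 1 - \sum_j normc (z 0 j) ^+ 2.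
Proof. by rewrite /gap enorm_sqr. Qed.

Lemma unit_ballE z : unit_ball z <-> 0 < gap z.
Proof. by rewrite /unit_ball /= /gap subr_gt0 expr_lt1 ?sqrtr_ge0. Qed.

Lemma gap_le1 z : gap z <= 1.
Proof. by rewrite /gap gerBl sqr_ge0. Qed.

Lemma measurable_gap : measurable_fun setT gap.
Proof.
rewrite (_ : gap = fun z => 1 - \sum_j (complex.Re (z 0 j) ^+ 2
    + complex.Im (z 0 j) ^+ 2)); last first.
  apply/funext => z; rewrite gapE; congr (_ - _).
  by apply: eq_bigr => j _; rewrite normc_sqr.
apply: measurable_funB => //; apply: measurable_sum => j.
have mj := @measurable_mx_entry _ _ 1 N 0 j.
apply: measurable_funD; apply: measurable_funX.
  exact: (measurableT_comp (@measurable_Re R) (mj _ _)).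
exact: (measurableT_comp (@measurable_Im R) (mj _ _)).
Qed.

Lemma measurable_unit_ball : measurable (@unit_ball R N).
Proof.
rewrite (_ : @unit_ball R N = setT `&` gap @^-1` `]0, +oo[); last first.
  by apply/seteqP; split=> z; rewrite setTI /= in_itv/= andbT => /unit_ballE.
exact: measurable_gap.
Qed.

Lemma normc_coord_le1 z j : unit_ball z -> normc (z 0 j) <= 1.
Proof.
move=> /unit_ballE; rewrite gapE subr_gt0 (bigD1 j)//= => zj.
rewrite -(@expr_le1 _ 2)// ?normc_ge0//.
apply: ltW; apply: le_lt_trans zj.
by rewrite lerDl sumr_ge0// => i _; exact: sqr_ge0.
Qed.

Lemma unit_ball_sub_box :
  @unit_ball R N `<=` box (fun=> 0) (fun=> 1).
Proof.
move=> z zb j; split; rewrite ?subr0.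
  by apply: le_trans (normc_ge_absRe _) _; exact: normc_coord_le1.
by apply: le_trans (normc_ge_absIm _) _; exact: normc_coord_le1.
Qed.

(** The half-diagonal is sqrt 2 times [d]; the cruder factor 2 avoids the root. *)
Lemma normc_square_le c d (x : R[i]) : square c d x ->
  normc (x - (c%:C)%C) <= 2 * d.
Proof.
case: x => a b; rewrite /square /= => -[ac b0].
have d0 : 0 <= d by exact: le_trans (normr_ge0 _) b0.
rewrite subr0 -[leRHS](ger0_norm (mulr_ge0 _ d0))// -sqrtr_sqr ler_wsqrtr//.
have := ler_pM (normr_ge0 _) (normr_ge0 _) ac ac.
have := ler_pM (normr_ge0 _) (normr_ge0 _) b0 b0.
by rewrite -!expr2 !real_normK ?num_real// exprMn => *; nra.
Qed.

(** Since [fine] sends [+oo] to 0 and the inverse of 0 is 0, the volume must be shown both finite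
    and positive; the ball is squeezed between two boxes. *)
Lemma volume_gt0 : 0 < (fine (lebesgue_Cn R N (@unit_ball R N)))^-1.
Proof.
(* In the box of half-side [e] each coordinate has modulus at most 2e = 1/(N+1), so the sum of
   squares is at most N/(N+1)^2 < 1. *)
rewrite invr_gt0; pose e : R := (2 * N.+1%:R)^-1.
have e0 : 0 < e by rewrite invr_gt0.
have upper : (lebesgue_Cn R N (@unit_ball R N) < +oo)%E.
  apply: (@le_lt_trans _ _ (lebesgue_Cn R N (box (fun=> 0) (fun=> 1)))).
    apply: le_measure; rewrite ?inE.
    - exact: measurable_unit_ball.
    - exact: measurable_box.
    - exact: unit_ball_sub_box.
  by rewrite lebesgue_box ?ltry.
apply: fine_gt0; rewrite upper andbT.
apply: (@lt_le_trans _ _ (lebesgue_Cn R N (box (fun=> 0) (fun=> e)))).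
  rewrite lebesgue_box; last by move=> _; exact: ltW.
  by rewrite lte_fin prodr_gt0// => j _; rewrite exprn_gt0// mulr_gt0.
apply: le_measure; rewrite ?inE.
- exact: measurable_box.
- exact: measurable_unit_ball.
move=> z zb; apply/unit_ballE; rewrite gapE subr_gt0.
have ze j : normc (z 0 j) ^+ 2 <= (2 * e) ^+ 2.
  rewrite -[z 0 j]subr0 ler_pXn2r ?nnegrE ?normc_ge0 ?mulr_ge0 ?(ltW e0)//.
  exact: normc_square_le (zb j).
apply: (@le_lt_trans _ _ (\sum_(j < N) (2 * e) ^+ 2)).
  by apply: ler_sum => j _; exact: ze.
rewrite sumr_const card_ord -[_ *+ N]mulr_natl {ze upper zb}.
have -> : 2 * e = N.+1%:R^-1 by rewrite /e invfM mulrA divff ?mul1r.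
rewrite exprVn ltr_pdivrMr ?exprn_gt0// mul1r -natrX ltr_nat.
by rewrite expnS expn1 mulSn ltn_addr.
Qed.

End ball.

(** * Lower bounds for the real part of the kernel *)

Section kernel.
Variable R : realType.

Lemma powR_le_comparable (c a x : R) : 0 < a -> a / 2 <= x <= 2 * a ->
  x `^ c <= 2 `^ `|c| * a `^ c.
Proof.
move=> a0 /andP[ax xa]; have x0 : 0 < x by lra.
have [c0|c0] := lerP 0 c.
  rewrite ger0_norm// -powRM ?(ltW a0)//.
  by apply: ge0_ler_powR; rewrite ?nnegrE//; lra.
have -> : `|c| = - c by rewrite ltr0_norm.
(* For negative [c] the roles are exchanged: a <= 2x is raised to the positive power [- c]. *)
have h : a `^ (- c) <= 2 `^ (- c) * x `^ (- c).
  rewrite -powRM ?(ltW x0)//.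
  by apply: ge0_ler_powR; rewrite ?nnegrE//; lra.
rewrite !powRN in h *.
have := powR_gt0 c x0; have := powR_gt0 c a0.
have := @powR_gt0 R 2 c ltac:(lra).
move: h; set X := x `^ c; set A := a `^ c; set B := 2 `^ c => h B0 A0 X0.
by move: h; rewrite ler_pdivlMr// ler_pdivrMl// [A * _]mulrC.
Qed.

Lemma powR_ge_comparable (c a x : R) : 0 < a -> a / 2 <= x <= 2 * a ->
  2 `^ (- `|c|) * a `^ c <= x `^ c.
Proof.
move=> a0 ax; have x0 : 0 < x by lra.
have := powR_le_comparable (- c) a0 ax; rewrite normrN !powRN => h.
have := powR_gt0 c x0; have := powR_gt0 c a0.
have := @powR_gt0 R 2 `|c| ltac:(lra).
move: h; set X := x `^ c; set A := a `^ c; set B := 2 `^ `|c| => h B0 A0 X0.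
by rewrite -lef_pV2 ?posrE ?mulr_gt0 ?invr_gt0// invfM invrK.
Qed.

Lemma Re_cpow_inv (z : R[i]) k : z != 0 ->
  complex.Re (cpow z k)^-1 = cos (k * arg z) * normc z `^ (- k).
Proof.
move=> z0; have n0 : 0 < normc z.
  by rewrite lt_def normc_ge0 andbT; apply/eqP => /eq0_normc zz; rewrite zz eqxx in z0.
have := powR_gt0 k n0; rewrite powRN /cpow.
have ReV (x : R[i]) : complex.Re x^-1 =
    complex.Re x / (complex.Re x ^+ 2 + complex.Im x ^+ 2) by case: x.
set n := _ `^ _ => n_gt0; rewrite ReV /=.
have -> : (n * cos (k * arg z)) ^+ 2 + (n * sin (k * arg z)) ^+ 2 = n ^+ 2.
  by rewrite !exprMn -mulrDr cos2Dsin2 mulr1.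
by field; rewrite gt_eqF.
Qed.

Lemma cos_small_angle (k : R) : exists2 d : R, 0 < d &
  forall u, 1 - d <= u <= 1 -> cos 1 <= cos (k * acos u).
Proof.
(* Angles up to [th] stay within 1 after multiplication by [|k|], and cos 1 is positive. *)
pose th : R := (`|k| + 1)^-1.
have k1 : 0 < `|k| + 1 by rewrite ltr_wpDl.
have th0 : 0 < th by rewrite invr_gt0.
have th1 : th <= 1 by rewrite invf_le1// lerDr.
have pi2 : 2 <= pi :> R by have := @pihalf_ge1 R; lra.
have cth : cos th < 1.
  by rewrite -cos0 ltr_cos// in_itv/=; lra.
(* The bound 1 - cos th forces u >= cos th, hence acos u <= th; the bound 1 keeps u in the domain of
   [acos]. *)
exists (Num.min 1 (1 - cos th)); first by rewrite lt_min; lra.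
move=> u /andP[]; rewrite lerBlDr -lerBlDl le_min => /andP[u1 uc] ule1.
have u11 : -1 <= u <= 1 by lra.
have a0 := acos_ge0 u11; have api := acos_lepi u11.
have ath : acos u <= th.
  rewrite leNgt; apply/negP => thu.
  have : cos (acos u) < cos th by rewrite ltr_cos// in_itv/=; lra.
  by rewrite acosK ?in_itv//=; lra.
rewrite -[X in _ <= X]cos_norm normrM (ger0_norm a0).
have ka : `|k| * acos u <= 1.
  apply: (@le_trans _ _ (`|k| * th)); first by rewrite ler_wpM2l.
  by rewrite ler_pdivrMr// mul1r lerDl.
by rewrite leNgt ltr_cos -?leNgt// in_itv/= ?mulr_ge0//=; lra.
Qed.

(** A point close to a > 0 relative to [a] has modulus comparable to [a] and an argument so small
    that [k] times it stays within 1 of 0. *)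
Lemma kernel_lower_bound (k : R) : exists d c : R, [/\ 0 < d, d <= 2^-1, 0 < c &
  forall (a : R) (z : R[i]), 0 < a -> normc (z - (a%:C)%C) <= d * a ->
    c * a `^ (- k) <= complex.Re (cpow z k)^-1].
Proof.
have [e e0 he] := cos_small_angle k.
(* The bound 1/2 puts |z| between a/2 and 2a; the bound e/2 gives Re z / |z| >= (1 - d)/(1 + d) >= 1
   - 2d >= 1 - e. *)
exists (Num.min 2^-1 (e / 2)), (cos 1 * 2 `^ (- `|k|)); split.
- by rewrite lt_min; lra.
- by rewrite ge_min lexx.
- by rewrite mulr_gt0 ?cos1_gt0// powR_gt0.
move=> a z a0; set d := Num.min _ _ => za.
have [d2 de] : d <= 2^-1 /\ d <= e / 2.
  by split; rewrite /d ge_min lexx ?orbT.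
have Rez : a - d * a <= complex.Re z.
  have := le_trans (normc_ge_absRe _) za; case: z {za} => x y /=.
  by rewrite ler_norml => /andP[]; lra.
have nz : normc z <= a + d * a.
  rewrite -[z](subrK (a%:C)%C) (le_trans (le_normcD _ _))//.
  by rewrite addrC lerD//= expr0n /= addr0 sqrtr_sqr ger0_norm// ltW.
have Rn : complex.Re z <= normc z.
  by apply: le_trans (normc_ge_absRe _); exact: ler_norm.
have n0 : 0 < normc z by nra.
have z0 : z != 0.
  by apply/eqP => z0; move: n0; rewrite z0 normc0 ltxx.
rewrite Re_cpow_inv// -mulrA; apply: ler_pM.
- by rewrite ltW// cos1_gt0.
- by rewrite mulr_ge0// powR_ge0.
(* The two branches of [arg] differ by a sign, which the cosine ignores. *)
- have -> : cos (k * arg z) = cos (k * acos (complex.Re z / normc z)).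
    by rewrite /arg; case: ifPn => // _; rewrite mulrN cosN.
  apply: he; rewrite ler_pdivlMr// ler_pdivrMr//; apply/andP; split; nra.
- by rewrite -(normrN k); apply: powR_ge_comparable => //; apply/andP; split; nra.
Qed.

End kernel.

(** * Testing the continuity of the operator on nonnegative functions *)

Section testing.
Local Open Scope ereal_scope.
Variables (R : realType) (N : nat) (s t p q Q : R) (omega : 'rV[R[i]]_N -> R).
Local Notation ball := (@unit_ball R N).
Local Notation mu := (muB R N).
Hypotheses (p0 : (0 < p)%R) (womega : weight omega).
Hypothesis bounded_P : well_defined_continuous s t p q Q omega.

Lemma weight_ae_pos : exists Z : set 'rV[R[i]]_N, [/\ measurable Z, mu Z = 0 &
  forall z, ball z -> ~ Z z -> (0 < omega z)%R].
Proof.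
have [_ [Z [mZ Z0 hZ]] _] := womega; exists Z; split=> // z bz nZ.
by apply: contrapT => oz; apply/nZ/hZ => /= /(_ bz).
Qed.

Lemma measurable_gap_powR D c : measurable_fun D (fun z => @gap R N z `^ c)%R.
Proof.
apply: measurable_funTS; apply: (measurableT_comp (measurable_powR c)).
exact: measurable_gap.
Qed.

Lemma measurable_weight_gap c :
  measurable_fun ball (fun z => `|omega z| * gap z `^ c)%R.
Proof.
have [mo _ _] := womega.
by apply: measurable_funM; [exact: measurableT_comp|exact: measurable_gap_powR].
Qed.

(** The p-th power of the norm of [g] in the source space. The absolute value makes the integrand
    nonnegative everywhere and changes it only on a null set. *)
Let energy g := \int[mu]_(z in ball) (g z `^ p * (`|omega z| * gap z `^ q))%:E.

Lemma Lp_norm_real (g : 'rV[R[i]]_N -> R) : measurable_fun ball g ->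
  (forall z, ball z -> 0 <= g z)%R ->
  Lp_norm omega p q (fun z => (g z)%:C%C) = energy g `^ p^-1.
Proof.
move=> mg g0; have [Z [mZ Z0 oZ]] := weight_ae_pos; have [mo _ _] := womega.
have mgp : measurable_fun ball (fun z => g z `^ p)%R.
  exact: measurableT_comp (measurable_powR p) mg.
congr (_ `^ _); apply: ae_eq_integral => //.
- exact: measurable_unit_ball.
- apply/measurable_EFinP; apply: measurable_funM; last exact: measurable_gap_powR.
  apply: measurable_funM => //; apply: (measurableT_comp (measurable_powR p)).
  rewrite (_ : (fun z => normc _) = Num.norm \o g); last first.
    by apply/funext => z; rewrite /= expr0n addr0 sqrtr_sqr.
  exact: measurableT_comp.
- apply/measurable_EFinP; apply: measurable_funM => //.
  exact: measurable_weight_gap.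
exists Z; split=> // z /= zE; apply: contrapT => nZ; apply: zE => bz.
rewrite expr0n addr0 sqrtr_sqr (ger0_norm (g0 z bz)) -mulrA.
by rewrite (gtr0_norm (oZ z bz nZ)).
Qed.

Lemma in_Lp_real (g : 'rV[R[i]]_N -> R) : measurable_fun ball g ->
  (forall z, ball z -> 0 <= g z)%R -> energy g < +oo ->
  in_Lp omega p q (fun z => (g z)%:C%C).
Proof.
move=> mg g0 Ioo; split; first exact: measurableT_comp (@measurable_real_complex R) mg.
by rewrite Lp_norm_real// poweR_lty.
Qed.

Lemma operator_bound : exists2 C : R, (0 <= C)%R &
  forall g : 'rV[R[i]]_N -> R, measurable_fun ball g ->
  (forall z, ball z -> 0 <= g z)%R -> energy g < +oo ->
  \int[mu]_(z in ball)
    (normc (Pop s t (fun w => (g w)%:C%C) z) `^ p * omega z * gap z `^ Q)%:E <=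
  C%:E * energy g.
Proof.
(* The given constant may be negative, so it is replaced by its maximum with 0 before the norm
   inequality is raised to the power [p]. *)
have [_ [C hC]] := bounded_P; exists (Num.max C 0 `^ p)%R; first exact: powR_ge0.
move=> g mg g0 Ioo; have [Z [mZ Z0 oZ]] := weight_ae_pos.
have mball := @measurable_unit_ball R N.
have I0 : 0 <= energy g.
  by apply: integral_ge0 => z _; rewrite lee_fin !mulr_ge0 ?powR_ge0.
have := hC _ (in_Lp_real mg g0 Ioo); rewrite Lp_norm_real// /Lp_norm.
set A := \int[mu]_(z in ball) _ => hA.
(* The weight may be negative on the null set [Z], so the sign of the integrand is known only off
   [Z]. *)
have A0 : 0 <= A.
  rewrite -[leLHS](integral0 mu ball); apply: (le_integral_off_null mball mZ Z0) => //.
  move=> z bz nZ /=; rewrite lee_fin mulr_ge0 ?powR_ge0//.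
  by rewrite mulr_ge0 ?powR_ge0// ltW// oZ.
have pK X : 0 <= X -> (X `^ p^-1) `^ p = X.
  by move=> X0; rewrite -poweRrM mulVf ?gt_eqF// poweRe1.
rewrite -[leLHS](pK A A0) -[energy g](pK _ I0) -poweR_EFin -poweRM ?poweR_ge0//; last first.
  by rewrite lee_fin le_max lexx orbT.
apply: gt0_ler_poweR; rewrite ?in_itv/= ?poweR_ge0 ?leey//; first exact: ltW.
  by rewrite andbT mule_ge0 ?poweR_ge0// lee_fin le_max lexx orbT.
by apply: (le_trans hA); rewrite lee_wpmul2r ?poweR_ge0// lee_fin le_max lexx.
Qed.

(** If the kernel has real part at least [c] between [A] and the support of [g], then |P g| >= c m
    h^t almost everywhere on [A]; this is raised to the power [p] and integrated against omega
    h^Q. *)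
Lemma testing_inequality : exists2 C : R, (0 <= C)%R &
  forall (g : 'rV[R[i]]_N -> R) (A : set 'rV[R[i]]_N) (c m : R),
  measurable_fun ball g -> (forall z, ball z -> 0 <= g z)%R ->
  measurable A -> A `<=` ball -> (0 <= c)%R -> (0 <= m)%R ->
  energy g < +oo ->
  (forall z w, A z -> ball w -> g w != 0 ->
    c <= complex.Re (cpow (1 - inner z w) (N%:R + 1 + s + t))^-1)%R ->
  m%:E <= \int[mu]_(w in ball) (g w * gap w `^ s)%:E ->
  ((c * m) `^ p)%:E * \int[mu]_(z in A) (`|omega z| * gap z `^ (t * p + Q))%:E
  <= C%:E * energy g.
Proof.
have [C C0 hC] := operator_bound; exists C => // g A c m mg g0 mA Ab c0 m0 Ioo kc mle.
apply: le_trans (hC g mg g0 Ioo).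
have [Z1 [mZ1 Z10 oZ]] := weight_ae_pos; have [mo _ _] := womega.
have mball := @measurable_unit_ball R N.
(* [Z1] is where positivity of the weight may fail, [Z2] where absolute convergence of the integral
   for this [g] may fail. *)
have [Z2 [mZ2 Z20 hZ2]] := bounded_P.1 _ (in_Lp_real mg g0 Ioo).
have mZ : measurable (Z1 `|` Z2) by exact: measurableU.
have Z0 : mu (Z1 `|` Z2) = 0.
  by rewrite (@measureU0 _ _ _ mu).
rewrite -ge0_integralZl//; last 3 first.
- by apply/measurable_EFinP; apply: measurable_funS (measurable_weight_gap _).
- by move=> z _; rewrite lee_fin mulr_ge0 ?powR_ge0.
- by rewrite lee_fin powR_ge0.
rewrite integral_mkcond [leRHS]integral_mkcond.
apply: (le_integral_off_null measurableT mZ Z0) => //.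
- apply/(measurable_restrictT _ mA)/measurable_EFinP; apply: measurable_funM => //.
  by apply: measurable_funS (measurable_weight_gap _).
- move=> z _; apply: erestrict_ge0 => {}z _.
  by rewrite lee_fin !mulr_ge0 ?powR_ge0.
move=> z _ /not_orP[nZ1 nZ2]; rewrite /patch.
case: ifPn => [/set_mem Az|nAz]; last first.
  case: ifPn => // /set_mem bz; rewrite lee_fin.
  by rewrite !mulr_ge0 ?powR_ge0// ltW// oZ.
have bz := Ab z Az; rewrite mem_set// lee_fin (gtr0_norm (oZ z bz nZ1)).
have [mF Foo] : Cintegrable (P_integrand s t (fun w => (g w)%:C%C) z).
  by apply: contrapT => h; apply/nZ2/hZ2 => /= /(_ bz).
set F := P_integrand _ _ _ _ in mF Foo *.
have ReF w : complex.Re (F w) = (g w * gap w `^ s *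
    complex.Re (cpow (1 - inner z w) (N%:R + 1 + s + t))^-1)%R.
  rewrite /F /P_integrand -/(gap w); case: ((cpow _ _)^-1)%R => x y /=.
  by ring.
have Fle w : ball w -> (c * (g w * gap w `^ s) <= complex.Re (F w))%R.
  move=> bw; rewrite ReF mulrC; have [->|gw] := eqVneq (g w) 0%R.
    by rewrite !mul0r.
  by rewrite ler_wpM2l ?mulr_ge0 ?powR_ge0 ?g0// kc.
have cmF : (c * m)%:E <= \int[mu]_(w in ball) (complex.Re (F w))%:E.
  apply: (@le_trans _ _ (\int[mu]_(w in ball) (c * (g w * gap w `^ s))%:E)).
    under eq_integral do rewrite EFinM; rewrite ge0_integralZl ?lee_fin//.
    + by rewrite EFinM lee_wpmul2l.
    + apply/measurable_EFinP; apply: measurable_funM => //.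
      exact: measurable_gap_powR.
    + by move=> w bw; rewrite lee_fin mulr_ge0 ?powR_ge0 ?g0.
  apply: le_integral_nonmeasurable => w bw; rewrite lee_fin.
    by rewrite !mulr_ge0 ?powR_ge0 ?g0.
  exact: Fle.
(* Finiteness matters: the real-valued integral in [Cintegral] would turn [+oo] into 0. *)
have Foo' : \int[mu]_(w in ball) (complex.Re (F w))%:E < +oo.
  apply: le_lt_trans Foo; apply: le_integral_nonmeasurable => w bw; rewrite lee_fin.
    by apply: le_trans (Fle w bw); rewrite !mulr_ge0 ?powR_ge0 ?g0.
  by apply: le_trans (normc_ge_absRe _); exact: ler_norm.
have cmI : (c * m <= complex.Re (Cintegral F))%R.
  rewrite -lee_fin /= /Rintegral fineK//.
  by rewrite ge0_fin_numE// (le_trans _ cmF)// lee_fin mulr_ge0.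
have : (gap z `^ t * (c * m) <= normc (Pop s t (fun w => (g w)%:C%C) z))%R.
  rewrite /Pop normcM [normc (_%:C)%C](_ : _ = gap z `^ t)%R; last first.
    by rewrite /= expr0n addr0 sqrtr_sqr ger0_norm ?powR_ge0.
  rewrite ler_wpM2l ?powR_ge0// (le_trans cmI)//.
  by apply: le_trans (normc_ge_absRe _); exact: ler_norm.
set X := normc _ => hX.
have gz : (0 < gap z)%R by exact/unit_ballE.
have Xp : ((c * m) `^ p * gap z `^ (t * p) <= X `^ p)%R.
  rewrite mulrC powRrM -powRM ?powR_ge0 ?mulr_ge0//.
  by apply: ge0_ler_powR; rewrite ?nnegrE ?normc_ge0 ?mulr_ge0 ?powR_ge0// ltW.
rewrite powRD ?(gt_eqF gz) ?implybT// [leLHS](_ : _ =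
  (c * m) `^ p * gap z `^ (t * p) * omega z * gap z `^ Q)%R; last by ring.
by rewrite ler_wpM2r ?powR_ge0// ler_wpM2r// ltW// oZ.
Qed.

End testing.

(** * Compactness and normalized measure of boxes *)

Section compact_box.
Variable R : realType.

Lemma normc_le_abs (x : R[i]) :
  normc x <= `|complex.Re x| + `|complex.Im x|.
Proof.
case: x => a b /=; rewrite -[leRHS]ger0_norm ?addr_ge0// -sqrtr_sqr.
rewrite ler_wsqrtr// sqrrD !real_normK ?num_real// lerD2r lerDl.
by rewrite mulrn_wge0// mulr_ge0.
Qed.

Lemma continuous_complex_of_pair :
  continuous (fun p : R * R => Complex p.1 p.2 : R[i]).
Proof.
(* The radius is a positive element of [R[i]], which the order of [R[i]] forces to be real. *)
move=> -[a b]; apply/(@cvgrPdist_lt R[i] R[i]) => -[e e'] /=.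
rewrite ltcE /= => /andP[/eqP -> e0].
have e20 : 0 < e / 2 by rewrite divr_gt0.
exists (ball a (e / 2), ball b (e / 2)).
  by split; exact: nbhsx_ballx.
move=> [x y] /= [xa yb].
rewrite normc_def ltcR; apply: le_lt_trans (normc_le_abs (Complex (a - x) (b - y))) _.
by move: xa yb; rewrite /ball /= => xa yb; lra.
Qed.

Lemma compact_square (c d : R) : compact (square c d).
Proof.
rewrite (_ : square c d = (fun p : R * R => Complex p.1 p.2 : R[i]) @`
    (`[c - d, c + d] `*` `[- d, d])).
  apply: continuous_compact; last by apply: compact_setX; exact: segment_compact.
  by apply: continuous_subspaceT; exact: continuous_complex_of_pair.
rewrite -square_preimage; apply/seteqP; split=> [[x y] xy|_ [[x y] xy <-]//].
by exists (x, y).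
Qed.

(** Local integrability of a weight is stated on compact sets; this makes its mass on a box inside
    the ball finite. *)
Lemma compact_box n (c d : 'I_n -> R) : compact (box c d).
Proof.
by apply: (@rV_compact R[i] n (fun j => square (c j) (d j))) => j; exact: compact_square.
Qed.

Lemma muB_box n (c d : 'I_n -> R) : (forall j, 0 <= d j) ->
  muB R n (box c d) =
  ((fine (lebesgue_Cn R n (@unit_ball R n)))^-1 * \prod_j (2 * d j) ^+ 2)%:E.
Proof.
move=> d0; by rewrite EFinM -(lebesgue_box c).
Qed.

Lemma muB_box_gt0 n (c d : 'I_n -> R) : (forall j, 0 < d j) ->
  (0 < muB R n (box c d))%E.
Proof.
move=> d0; rewrite muB_box => [|j]; last exact: ltW.
rewrite lte_fin mulr_gt0 ?volume_gt0// prodr_gt0// => j _.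
by rewrite exprn_gt0// mulr_gt0.
Qed.

End compact_box.

(** * Anisotropic boxes near the boundary *)

Section bergman_box.
Variables (R : realType) (n : nat).
Local Notation N := n.+1.
Implicit Types z w : 'rV[R[i]]_N.

Lemma normc_conj (x : R[i]) : normc (x^*)%R = normc x.
Proof. by case: x => a b /=; rewrite sqrrN. Qed.

Lemma le_normc_sum (I : finType) (F : I -> R[i]) :
  normc (\sum_i F i) <= \sum_i normc (F i).
Proof.
elim/big_ind2 : _ => [|x1 x2 y1 y2 h1 h2|//]; first by rewrite normc0.
by apply: le_trans (le_normcD _ _) _; exact: lerD.
Qed.

Lemma Re_one_sub_inner z : complex.Re (1 - inner z z) = gap z.
Proof.
by rewrite gapE -Re_innerzz; case: (inner z z).
Qed.

(* The anisotropic box around (sqrt (1 - h), 0, ..., 0), comparable to a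
   Bergman ball: it has volume of order h^(N+1). *)
Definition bergman_center (h : R) (j : 'I_N) : R :=
  if j == ord0 then Num.sqrt (1 - h) else 0.
Definition bergman_radius (e h : R) (j : 'I_N) : R :=
  if j == ord0 then e * h else e * Num.sqrt h.
Definition bergman_box e h := box (bergman_center h) (bergman_radius e h).

(** With r = sqrt (1 - h), the first coordinates differ from r by O(e h), and the others, of size
    O(e sqrt h), enter only through products of two. The error is at most (6 + n) e h, below 8 N e h
    = d h. *)
Lemma bergman_box_inner (d h : R) z w : 0 < d <= 2^-1 -> 0 < h <= 2^-1 ->
  bergman_box (d / (8 * N%:R)) h z -> bergman_box (d / (8 * N%:R)) h w ->
  normc (1 - inner z w - (h%:C)%C) <= d * h.
Proof.
move=> /andP[d0 d2] /andP[h0 h2]; set e := d / _ => zb wb.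
have N1 : 1 <= N%:R :> R by rewrite ler1n.
have N0 : 0 < N%:R :> R by rewrite ltr0n.
have e0 : 0 < e by rewrite divr_gt0 ?mulr_gt0.
have de : d = e * (8 * N%:R) by rewrite /e divfK// gt_eqF ?mulr_gt0.
have e1 : 16 * e <= 1 by nra.
set r := Num.sqrt (1 - h).
have r0 : 0 <= r by exact: sqrtr_ge0.
have r2 : r * r = 1 - h by rewrite -expr2 sqr_sqrtr//; lra.
have r1 : r <= 1 by nra.
have z0r : normc (z 0 ord0 - (r%:C)%C) <= 2 * (e * h) by exact: normc_square_le (zb ord0).
have w0r : normc (w 0 ord0 - (r%:C)%C) <= 2 * (e * h) by exact: normc_square_le (wb ord0).
have w0 : normc (w 0 ord0) <= 2.
  rewrite -[w 0 ord0](subrK (r%:C)%C) (le_trans (le_normcD _ _))//.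
  by rewrite [X in _ + X](_ : _ = r) /= ?expr0n ?addr0 ?sqrtr_sqr ?ger0_norm//; nra.
have tail (u : 'rV[R[i]]_N) j : bergman_box e h u ->
    normc (u 0 (lift ord0 j)) <= 2 * (e * Num.sqrt h).
  by move=> /(_ (lift ord0 j)) uj; rewrite -[u 0 _]subr0; exact: normc_square_le uj.
rewrite /inner big_ord_recl.
set x := z 0 ord0 in z0r *; set y := w 0 ord0 in w0r w0 *; set S := \sum_(i < n) _.
have -> : 1 - (x * y^* + S) - (h%:C)%C =
    - ((x - (r%:C)%C) * y^* + (r%:C)%C * (y - (r%:C)%C)^* + S).
  have -> : 1 - (x * y^* + S) - (h%:C)%C = ((1 - h)%:C)%C - x * y^* - S.
    by rewrite rmorphB /= ; ring.
  have conjr : ((r%:C)%C : R[i])^* = (r%:C)%C.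
    by apply/eqP; rewrite eq_complex /= oppr0 !eqxx.
  rewrite -r2 rmorphM [(y - _)^*]rmorphB /= conjr.
  ring.
rewrite normcN (le_trans (le_normcD _ _))//.
(* Each product is at most 4 e^2 h, and 4 e <= 1. *)
have S1 : normc S <= \sum_(i < n) (e * h).
  apply: le_trans (le_normc_sum _) _; apply: ler_sum => i _.
  rewrite normcM normc_conj.
  have := ler_pM (normc_ge0 _) (normc_ge0 _) (tail z i zb) (tail w i wb).
  have : Num.sqrt h * Num.sqrt h = h by rewrite -expr2 sqr_sqrtr// ltW.
  move=> hh; move/le_trans; apply.
  rewrite [leLHS](_ : _ = 4 * e * (e * (Num.sqrt h * Num.sqrt h))); last by ring.
  by rewrite hh ger_pMl ?mulr_gt0//; lra.
have S0 : normc ((x - (r%:C)%C) * y^* + (r%:C)%C * (y - (r%:C)%C)^*) <= 6 * (e * h).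
  apply: le_trans (le_normcD _ _) _; rewrite !normcM !normc_conj.
  have -> : normc (r%:C)%C = r by rewrite /= expr0n addr0 sqrtr_sqr ger0_norm.
  have := ler_pM (normc_ge0 _) (normc_ge0 _) z0r w0.
  have := ler_pM r0 (normc_ge0 _) r1 w0r.
  by lra.
apply: le_trans (lerD S0 S1) _.
rewrite sumr_const card_ord -[_ *+ n]mulr_natl de -natr1.
have eh := mulr_gt0 e0 h0.
have := mulr_ge0 (ler0n R n) (ltW eh); lra.
Qed.

(** The diagonal case w = z of [bergman_box_inner]: |gap z - h| <= d h <= h/2. *)
Lemma bergman_box_gap (d h : R) z : 0 < d <= 2^-1 -> 0 < h <= 2^-1 ->
  bergman_box (d / (8 * N%:R)) h z -> h / 2 <= gap z <= 2 * h.
Proof.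
move=> d0 h0 zb; have := bergman_box_inner d0 h0 zb zb.
move=> /(le_trans (normc_ge_absRe _)).
have -> : complex.Re (1 - inner z z - (h%:C)%C) = gap z - h.
  by rewrite -Re_one_sub_inner; case: (inner z z).
rewrite ler_norml => /andP[? ?]; nra.
Qed.

(** The first coordinate contributes h^2 and each of the N - 1 others contributes h. *)
Lemma muB_bergman_box (e h : R) : 0 <= e -> 0 <= h ->
  muB R N (bergman_box e h) =
  ((fine (lebesgue_Cn R N (@unit_ball R N)))^-1 * (2 * e) ^+ (2 * N) * h `^ (N%:R + 1))%:E.
Proof.
move=> e0 h0; rewrite muB_box => [|j]; last first.
  by rewrite /bergman_radius; case: ifP => _; rewrite mulr_ge0 ?sqrtr_ge0.
rewrite -mulrA; congr (_ * _)%:E.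
rewrite big_ord_recl /bergman_radius eqxx.
rewrite (eq_bigr (fun=> (2 * e) ^+ 2 * h)) => [|i _]; last first.
  by rewrite mulrA exprMn sqr_sqrtr.
rewrite prodr_const card_ord natr1 powR_mulrn// exprM [(_ * h) ^+ n]exprMn.
by rewrite [(_ ^+ 2) ^+ n.+1]exprS [h ^+ n.+2]exprS [h ^+ n.+1]exprS; ring.
Qed.

End bergman_box.

Lemma powR_blowup (R : realType) (a D : R) : a < 0 ->
  exists2 h : R, 0 < h <= 2^-1 & D <= h `^ a.
Proof.
move=> a0; pose E := Num.max 1 D; have E0 : 0 < E by rewrite lt_max ltr01.
have E'0 : 0 < E `^ a^-1 by exact: powR_gt0.
(* As a < 0, h <= E^(1/a) gives h^a >= E >= D. *)
exists (Num.min 2^-1 (E `^ a^-1)).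
  by rewrite lt_min E'0 invr_gt0 ltr0n ge_min lexx.
apply: (@le_trans _ _ E); first by rewrite le_max lexx orbT.
set m := Num.min _ _; have m0 : 0 < m by rewrite lt_min E'0 invr_gt0 ltr0n.
have mE : m <= E `^ a^-1 by rewrite ge_min lexx orbT.
rewrite -[a]opprK powRN -[leLHS]invrK lef_pV2 ?posrE ?invr_gt0 ?powR_gt0//.
rewrite (_ : E^-1 = (E `^ a^-1) `^ (- a)); last first.
  by rewrite -powRrM mulrN mulVf ?lt_eqF// powRN powRr1// ltW.
by apply: ge0_ler_powR; rewrite ?nnegrE ?oppr_ge0//; exact: ltW.
Qed.

(** * Case (ii): testing on a box near the boundary *)

Section no_gain.
Local Open Scope ereal_scope.
Variables (R : realType) (n : nat) (s t p q Q : R).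
Local Notation N := n.+1.
Variable omega : 'rV[R[i]]_N -> R.
Local Notation ball := (@unit_ball R N).
Local Notation mu := (muB R N).
Hypotheses (p0 : (0 < p)%R) (womega : weight omega).
Hypothesis bounded_P : well_defined_continuous s t p q Q omega.

(** A zero integral would make the weight vanish almost everywhere on [A], against its
    positivity. *)
Lemma weight_mass_gt0 (A : set 'rV[R[i]]_N) : measurable A -> A `<=` ball ->
  0 < mu A -> 0 < \int[mu]_(z in A) (`|omega z|)%:E.
Proof.
move=> mA Ab muA; rewrite lt0e integral_ge0 ?andbT; last first.
  by move=> z _; rewrite lee_fin.
apply/eqP => I0; have [mo _ _] := womega.
have [Z [mZ Z0 oZ]] := weight_ae_pos womega.
have mA' : measurable_fun A (fun z => (omega z)%:E).
  by apply/measurable_EFinP; apply: measurable_funS mo; first exact: measurable_unit_ball.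
have [/(_ I0)[Y [mY Y0 hY]] _] := ae_eq_integral_abs mu mA mA'.
suff : mu A = 0 by move=> A0; rewrite A0 ltxx in muA.
have ZY0 : mu (Z `|` Y) = 0 by rewrite (@measureU0 _ _ _ mu).
apply: (subset_measure0 mA (measurableU _ _ mZ mY) _ ZY0).
move=> z Az; have [Zz|nZ] := pselect (Z z); [by left|right].
apply: hY => /= /(_ Az) [] oz0; have := oZ z (Ab z Az) nZ.
by rewrite oz0 ltxx.
Qed.

Lemma weight_mass_lty (c d : 'I_N -> R) : box c d `<=` ball ->
  \int[mu]_(z in box c d) (`|omega z|)%:E < +oo.
Proof. by have [_ _ h] := womega => bb; apply: h => //; exact: compact_box. Qed.

(** The same box serves as support of the test function and as test set, so the weight enters both
    sides only through its mass [W] on the box, which cancels. *)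
Lemma no_gain : (q <= Q)%R.
Proof.
rewrite leNgt; apply/negP => Qq.
have [C C0 hC] := testing_inequality p0 womega bounded_P.
pose k : R := (N%:R + 1 + s + t)%R.
have [d [kap [d0 d2 kap0 hkap]]] := kernel_lower_bound k.
pose v0 : R := ((fine (lebesgue_Cn R N ball))^-1 *
  (2 * (d / (8 * N%:R))) ^+ (2 * N))%R.
have v00 : (0 < v0)%R.
  by rewrite mulr_gt0 ?volume_gt0// exprn_gt0// mulr_gt0// divr_gt0// mulr_gt0.
pose c1 := (kap * (2 `^ (- `|s|) * v0))%R.
have c10 : (0 < c1)%R by rewrite mulr_gt0// mulr_gt0// powR_gt0.
pose c2 : R := (2 `^ (- `|t * p + Q|))%R.
have c20 : (0 < c2)%R by rewrite powR_gt0.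
pose c3 : R := (2 `^ `|q|)%R.
have cc0 : (0 < c1 `^ p * c2)%R by rewrite mulr_gt0// powR_gt0.
(* The threshold is the bound that the final inequality imposes on h^(Q - q); the added 1 makes the
   contradiction strict. *)
have [|h h02] := @powR_blowup R (Q - q) (C * c3 / (c1 `^ p * c2) + 1).
  by rewrite subr_lt0.
apply/negP; rewrite -ltNge (@le_lt_trans _ _ (C * c3 / (c1 `^ p * c2))%R)//; last first.
  by rewrite ltrDl.
have /andP[h0 h2] := h02.
have dd : (0 < d <= 2^-1)%R by rewrite d0 d2.
pose e : R := (d / (8 * N%:R))%R; pose B := bergman_box e h : set 'rV[R[i]]_N.
have e0 : (0 < e)%R by rewrite divr_gt0// mulr_gt0.
have gapB z : B z -> (h / 2 <= gap z <= 2 * h)%R by exact: bergman_box_gap.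
have Bb : B `<=` ball.
  by move=> z /gapB/andP[+ _]; move=> hz; apply/unit_ballE; lra.
have mB : measurable B by exact: measurable_box.
have muBB : mu B = (v0 * h `^ (N%:R + 1))%:E.
  by rewrite muB_bergman_box// ltW.
have := weight_mass_gt0 mB Bb; have := weight_mass_lty Bb.
have : 0 < mu B by rewrite muBB lte_fin mulr_gt0// powR_gt0.
set W := \int[mu]_(z in B) _ => muB0 Woo /(_ muB0) W0.
pose g : 'rV[R[i]]_N -> R := \1_B.
have mg : measurable_fun ball g by exact: measurable_indic.
have g0 z : ball z -> (0 <= g z)%R by rewrite /g indicE.
have g1 z : B z -> g z = 1%R by move=> Bz; rewrite /g indicE mem_set.
have gN z : ~ B z -> g z = 0%R by move=> Bz; rewrite /g indicE memNset.
have mov : measurable_fun B (fun z => (`|omega z|)%:E).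
  have [mo _ _] := womega; apply/measurable_EFinP; apply: measurableT_comp => //.
  by apply: measurable_funS mo => //; exact: measurable_unit_ball.
have intcW c : (0 <= c)%R -> \int[mu]_(z in B) (c%:E * (`|omega z|)%:E) = c%:E * W.
  by move=> c0; rewrite ge0_integralZl.
have energy_le : \int[mu]_(z in ball) (g z `^ p * (`|omega z| * gap z `^ q))%:E <=
    (c3 * h `^ q)%:E * W.
  rewrite (integral_supported _ Bb); last first.
    by move=> z _ nB; rewrite gN// powR0 ?gt_eqF// mul0r.
  rewrite -intcW ?mulr_ge0 ?powR_ge0//.
  apply: le_integral_nonmeasurable => z Bz.
    by rewrite lee_fin !mulr_ge0 ?powR_ge0.
  rewrite g1// powR1 mul1r -EFinM lee_fin mulrC ler_wpM2r//.
  exact: powR_le_comparable (gapB z Bz).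
have mass_ge : (c2 * h `^ (t * p + Q))%:E * W <=
    \int[mu]_(z in B) (`|omega z| * gap z `^ (t * p + Q))%:E.
  rewrite -intcW ?mulr_ge0 ?powR_ge0//.
  apply: le_integral_nonmeasurable => z Bz.
    by rewrite -EFinM lee_fin !mulr_ge0 ?powR_ge0.
  rewrite -EFinM lee_fin mulrC ler_wpM2l//.
  exact: powR_ge_comparable (gapB z Bz).
pose m : R := (2 `^ (- `|s|) * h `^ s * (v0 * h `^ (N%:R + 1)))%R.
have m0 : (0 <= m)%R.
  by apply: mulr_ge0; apply: mulr_ge0; rewrite ?powR_ge0//; exact: ltW.
have mle : m%:E <= \int[mu]_(w in ball) (g w * gap w `^ s)%:E.
  rewrite (integral_supported _ Bb); last by move=> z _ nB; rewrite gN// mul0r.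
  rewrite /m EFinM -muBB -integral_cst//.
  apply: le_integral_nonmeasurable => z Bz /=.
    by rewrite lee_fin mulr_ge0 ?powR_ge0.
  rewrite g1// mul1r lee_fin.
  exact: powR_ge_comparable (gapB z Bz).
have kker z w : B z -> ball w -> g w != 0%R ->
    (kap * h `^ (- k) <= complex.Re (cpow (1 - inner z w) (N%:R + 1 + s + t))^-1)%R.
  move=> Bz _ gw; have Bw : B w by apply: contrapT => /gN gw0; rewrite gw0 eqxx in gw.
  by apply: hkap => //; exact: bergman_box_inner.
have kaph : (0 <= kap * h `^ (- k))%R by rewrite mulr_ge0 ?powR_ge0// ltW.
have energy_lty : \int[mu]_(z in ball) (g z `^ p * (`|omega z| * gap z `^ q))%:E < +oo.
  by apply: (le_lt_trans energy_le); rewrite lte_mul_pinfty// lee_fin mulr_ge0 ?powR_ge0.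
have := hC g B _ m mg g0 mB Bb kaph m0 energy_lty kker mle.
(* The exponents from the kernel, the density h^s and the volume add up to -k + s + N + 1 = -t. *)
have -> : (kap * h `^ (- k) * m = c1 * h `^ (- t))%R.
  rewrite (_ : (- t = - k + (s + (N%:R + 1)))%R); last by rewrite /k; ring.
  rewrite /m /c1 !(@powRD _ h) ?(gt_eqF h0) ?implybT//.
  by ring.
have Wfin : W \is a fin_num by rewrite ge0_fin_numE// ltW.
rewrite -(fineK Wfin) in mass_ge energy_le W0 *; set w := fine W in mass_ge energy_le W0 *.
move=> key; have {key} : (((c1 * h `^ (- t)) `^ p * (c2 * h `^ (t * p + Q)) * w)%:E <=
    (C * (c3 * h `^ q) * w)%:E).
  rewrite [leLHS](_ : _ = ((c1 * h `^ (- t)) `^ p)%:E *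
    ((c2 * h `^ (t * p + Q))%:E * w%:E)); last by rewrite -!EFinM -!mulrA.
  apply: (@le_trans _ _ (C%:E * ((c3 * h `^ q)%:E * w%:E))).
    apply: le_trans (le_trans key (lee_wpmul2l _ energy_le)); last by rewrite lee_fin.
    by apply: lee_wpmul2l mass_ge; rewrite lee_fin powR_ge0.
  by rewrite -!EFinM -!mulrA.
(* After division by the mass [w] and cancellation of h^(-tp), what remains is c1^p c2 h^Q <= C c3
   h^q. *)
rewrite lee_fin ler_pM2r// powRM ?powR_ge0 ?(ltW c10)// -powRrM.
rewrite powRB ?(gt_eqF h0) ?implybT// ler_pdivrMr ?powR_gt0//.
rewrite [X in _ -> (_ <= X)%R]mulrAC ler_pdivlMr//; congr (_ <= _)%R; last by ring.
rewrite powRD ?(gt_eqF h0) ?implybT// mulNr powRN.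
by field; rewrite gt_eqF// powR_gt0.
Qed.

End no_gain.

(** * The function 1/(1 - |z|^2) is not integrable on the ball *)

Section divergence.
Variable R : realType.
Local Notation leb := (@lebesgue_measure R).

(** On [b m, b (m+1)), of length a 2^-m / 2, one has a^2 - x^2 = (a - x)(a + x) <= 2a * a 2^-m; each
    of these intervals therefore contributes at least 1/(4a). *)
Lemma integral_inv_diff_sqr (a : R) : 0 < a ->
  (\int[leb]_(x in `[0%R, a[) ((a ^+ 2 - x ^+ 2) `^ (-1))%:E = +oo)%E.
Proof.
move=> a0; pose f x : \bar R := ((a ^+ 2 - x ^+ 2) `^ (-1))%:E.
pose b m : R := a * (1 - 2 ^- m).
have pow0 m : 0 < 2 ^- m :> R by rewrite invr_gt0 exprn_gt0.
have bS m : b m.+1 = b m + a * 2 ^- m / 2.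
  by rewrite /b exprS; field; rewrite gt_eqF ?exprn_gt0.
have b_lt m : b m < a by rewrite /b; have := mulr_gt0 a0 (pow0 m); lra.
have bS_gt m : b m < b m.+1.
  by rewrite bS; have := mulr_gt0 a0 (pow0 m); lra.
have b0 m : 0 <= b m.
  elim: m => [|m bm]; first by rewrite /b expr0 invr1 subrr mulr0.
  exact: le_trans bm (ltW (bS_gt m)).
have f0 x : (0 <= f x)%E by rewrite lee_fin powR_ge0.
have mf D : measurable_fun D f.
  apply/measurable_EFinP/measurable_funTS.
  apply: (measurableT_comp (measurable_powR (-1))).
  by apply: measurable_funB => //; exact: measurable_funX.
have step m : ((m%:R * (4 * a)^-1)%:E <= \int[leb]_(x in `[0%R, b m[) f x)%E.
  elim: m => [|m IH]; first by rewrite mul0r; exact: integral_ge0.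
  rewrite (_ : `[0, b m.+1[ = `[0, b m[ `|` `[b m, b m.+1[)%classic; last first.
    by apply: itv_bndbnd_setU; rewrite bnd_simp// ltW.
  rewrite ge0_integral_setU//; first last.
  - apply/disj_setPS => x [] /=; rewrite !in_itv/= => /andP[_ xb] /andP[bx _].
    by rewrite ltNge bx in xb.
  - exact: mf.
  rewrite -natr1 mulrDl mul1r EFinD leeD//.
  apply: (@le_trans _ _ (\int[leb]_(x in `[b m, b m.+1[)
      ((2 * a * (a * 2 ^- m))^-1)%:E)%E).
    rewrite integral_cst//= lebesgue_measure_itv/= lte_fin bS_gt -EFinB -EFinM.
    rewrite lee_fin bS le_eqVlt; apply/orP; left; apply/eqP.
    have := pow0 m; set u := 2 ^- m => u0.
    by field; rewrite !gt_eqF.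
  apply: le_integral_nonmeasurable => x /=.
    have := pow0 m => u0.
    by rewrite lee_fin invr_ge0 ltW// !mulr_gt0.
  rewrite in_itv/= => /andP[bx xb]; have xa := lt_trans xb (b_lt _).
  have x0 := le_trans (b0 m) bx.
  have ax : 0 < a ^+ 2 - x ^+ 2 by nra.
  rewrite lee_fin powR_inv1 ?(ltW ax)// lef_pV2 ?posrE//; last first.
    by have := pow0 m => u0; rewrite !mulr_gt0.
  have axu : a - x <= a * 2 ^- m by move: bx; rewrite /b; lra.
  rewrite subr_sqr mulrC ler_pM//; lra.
apply/eqyP => A A0; pose m := (Num.truncn (A * (4 * a))).+1.
apply: (@le_trans _ _ (m%:R * (4 * a)^-1)%:E).
  rewrite lee_fin ler_pdivlMr ?mulr_gt0// ltW// /m.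
  exact: truncnS_gt.
apply: le_trans (step m) _; apply: ge0_subset_integral => //; first exact: mf.
by move=> x /=; rewrite !in_itv/= => /andP[-> /lt_trans ->].
Qed.

Lemma Ccons_normc_sqr n (z0 : R[i]) (z : 'rV[R[i]]_n) :
  gap (Ccons (z0, z)) = 1 - (normc z0 ^+ 2 + \sum_j normc (z 0 j) ^+ 2).
Proof.
rewrite gapE big_ord_recl; congr (1 - (normc _ ^+ 2 + _)).
  by rewrite mxE; case: splitP => // j _; rewrite mxE.
apply: eq_bigr => j _; congr (normc _ ^+ 2).
by rewrite -rshift1 (row_mxEr (const_mx z0 : 'rV_1)).
Qed.

(** By Tonelli: once all real variables except x = Re z_0 are fixed in a small box, the gap is a^2 -
    x^2 with a > 0, and the integral in x diverges. The fixed variables range over a set of positive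
    measure. *)
Lemma integral_inv_gap n :
  (\int[muB R n.+1]_(z in @unit_ball R n.+1) (gap z `^ (-1))%:E = +oo)%E.
Proof.
set mu := muB _ _; set ball := @unit_ball _ _.
pose F : 'rV[R[i]]_n.+1 -> \bar R := (fun z => (gap z `^ (-1))%:E) \_ ball.
have mF : measurable_fun setT F.
  apply/(measurable_restrictT _ (@measurable_unit_ball R n.+1)).
  apply/measurable_EFinP/measurable_funTS.
  by apply: (measurableT_comp (measurable_powR (-1))); exact: measurable_gap.
have F0 z : (0 <= F z)%E by apply: erestrict_ge0 => {}z _; rewrite lee_fin powR_ge0.
rewrite integral_mkcond -/F ge0_integral_mscale//.
suff -> : (\int[lebesgue_Cn R n.+1]_z F z = +oo)%E.
  by rewrite gt0_muley// lte_fin volume_gt0.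
have -> : (\int[lebesgue_Cn R n.+1]_z F z = 
    \int[lebesgue_complex R \x lebesgue_Cn R n]_u F (Ccons u))%E.
  by apply: (@ge0_integral_pushforward _ _ _ _ R _ (@measurable_Ccons R n)
    (product_measure (lebesgue_complex R) (lebesgue_Cn R n)) setT F).
rewrite fubini_tonelli2//; last exact: measurableT_comp mF (@measurable_Ccons R n).
pose e : R := (2 * n.+1%:R)^-1.
have e0 : 0 < e by rewrite invr_gt0 mulr_gt0.
apply: (@integral_eq_pinfty _ _ _ _ (box (fun=> 0) (fun=> e))).
- exact: measurable_box.
- have : (0 < lebesgue_Cn R n (box (fun=> 0%R) (fun=> e)))%E; last by [].
  rewrite lebesgue_box => [|_]; last exact: ltW.
  by rewrite lte_fin prodr_gt0// => j _; rewrite exprn_gt0 ?mulr_gt0.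
- by move=> z; exact: integral_ge0.
move=> z ze; rewrite /fubini_G.
have mFz : measurable_fun setT (fun z0 => F (Ccons (z0, z))).
  apply: (measurableT_comp mF).
  by apply: (measurableT_comp (@measurable_Ccons R n)); exact: measurable_fun_pair.
have -> : (\int[lebesgue_complex R]_z0 F (Ccons (z0, z)) =
    \int[leb \x leb]_u F (Ccons (complex_of_pair u, z)))%E.
  by apply: (@ge0_integral_pushforward _ _ _ _ R _ (@measurable_complex_of_pair R)
    (product_measure leb leb) setT (fun z0 => F (Ccons (z0, z)))).
have mFzp : measurable_fun setT (fun u => F (Ccons (complex_of_pair u, z))).
  exact: (measurableT_comp mFz (@measurable_complex_of_pair R)).
rewrite fubini_tonelli2//.
apply: (@integral_eq_pinfty _ (measurableTypeR R) R leb `[- e, e]%classic).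
- exact: measurable_itv.
- by rewrite /= lebesgue_measure_itv/= lte_fin ifT -?EFinB ?lte_fin; lra.
- by move=> y; exact: integral_ge0.
move=> y /=; rewrite in_itv/= => /andP[ye1 ye2]; rewrite /fubini_G.
pose S := \sum_j normc (z 0 j) ^+ 2.
have gapC x : gap (Ccons (Complex x y, z)) = 1 - y ^+ 2 - S - x ^+ 2.
  by rewrite Ccons_normc_sqr normc_sqr /= /S; ring.
have S1 : S <= n%:R * (2 * e) ^+ 2.
  apply: (@le_trans _ _ (\sum_(j < n) (2 * e) ^+ 2)).
    apply: ler_sum => j _.
    rewrite -[z 0 j]subr0 ler_pXn2r ?nnegrE ?normc_ge0 ?mulr_ge0 ?(ltW e0)//.
    exact: normc_square_le (ze j).
  by rewrite sumr_const card_ord -[_ *+ n]mulr_natl.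
have e1 : 2 * e * (n%:R + 1) = 1.
  by rewrite natr1 /e; field; rewrite addrC natr1 pnatr_eq0.
have a2 : 0 < 1 - y ^+ 2 - S.
  have n0 : 0 <= n%:R :> R by [].
  have : y ^+ 2 <= e ^+ 2 by nra.
  (* Since 2 e (n + 1) = 1, the claim is 4 n e^2 + e^2 < 4 (n + 1)^2 e^2. *)
  have : n%:R * (2 * e) ^+ 2 + e ^+ 2 < 1.
    rewrite [ltRHS](_ : _ = (2 * e * (n%:R + 1)) ^+ 2); last by rewrite e1 expr1n.
    have E0 := exprn_gt0 2 e0; have := mulr_ge0 n0 (ltW E0).
    by have := mulr_ge0 n0 (mulr_ge0 n0 (ltW E0)); lra.
  by lra.
pose a := Num.sqrt (1 - y ^+ 2 - S).
have a0 : 0 < a by rewrite sqrtr_gt0.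
have aE : a ^+ 2 = 1 - y ^+ 2 - S by rewrite sqr_sqrtr// ltW.
apply/eqP; rewrite eq_le leey /= -(integral_inv_diff_sqr a0) integral_mkcond.
apply: le_integral_nonmeasurable => x _.
  by apply: erestrict_ge0 => {}x _; rewrite lee_fin powR_ge0.
rewrite /patch; case: ifPn => // /set_mem /=; rewrite in_itv/= => /andP[x0 xa].
rewrite /F /patch mem_set ?gapC ?aE//; apply/unit_ballE.
by rewrite gapC -aE /= subr_gt0 ltr_pXn2r ?nnegrE ?(ltW a0).
Qed.

End divergence.

(** * Case (i): integrability of the weight and of its dual *)

Section integrability.
Local Open Scope ereal_scope.
Variables (R : realType) (n : nat) (s t p q Q : R).
Local Notation N := n.+1.
Variable omega : 'rV[R[i]]_N -> R.
Local Notation ball := (@unit_ball R N).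
Local Notation mu := (muB R N).
Hypotheses (p1 : (1 < p)%R) (womega : weight omega).
Hypothesis bounded_P : well_defined_continuous s t p q Q omega.

Let p0 : (0 < p)%R. Proof. exact: lt_trans p1. Qed.

Lemma muB_ball_lty : mu ball < +oo.
Proof.
apply: (@le_lt_trans _ _ (mu (box (fun=> 0%R) (fun=> 1%R)))).
  apply: le_measure; rewrite ?inE.
  - exact: measurable_unit_ball.
  - exact: measurable_box.
  - exact: unit_ball_sub_box.
by rewrite muB_box ?ltry.
Qed.

(* Near the center the kernel is bounded below, uniformly in the other variable. *)
Lemma central_box (k : R) : exists (e c : R), [/\ (0 < e)%R, (0 < c)%R,
  box (fun=> 0%R) (fun=> e) `<=` ball,
  (forall z, box (fun=> 0%R) (fun=> e) z -> (2^-1 <= @gap R N z <= 2)%R) &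
  forall z w, ball z -> ball w ->
    box (fun=> 0%R) (fun=> e) z \/ box (fun=> 0%R) (fun=> e) w ->
    (c <= complex.Re (cpow (1 - inner z w) k)^-1)%R].
Proof.
have [d [c [d0 d2 c0 hc]]] := kernel_lower_bound k.
have N0 : (0 < N%:R :> R)%R by rewrite ltr0n.
(* Coordinates in the box have modulus at most 2e = d/N, so |<z,w>| <= d when the other point is in
   the ball, and [kernel_lower_bound] applies with a = 1. *)
pose e : R := (d / N%:R / 2)%R.
have e0 : (0 < e)%R by rewrite !divr_gt0.
have small (z : 'rV[R[i]]_N) j : box (fun=> 0%R) (fun=> e) z ->
    (normc (z 0 j) <= d / N%:R)%R.
  move=> /(_ j) /normc_square_le; rewrite subr0 => /le_trans; apply.
  by rewrite /e mulrC divfK.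
have sumd : (\sum_(j < N) (d / N%:R) = d)%R.
  by rewrite sumr_const card_ord -[LHS]mulr_natr divfK// gt_eqF.
have gape z : box (fun=> 0%R) (fun=> e) z -> (2^-1 <= @gap R N z)%R.
  move=> ze; rewrite gapE.
  suff : (\sum_j normc (z 0%R j) ^+ 2 <= d)%R by lra.
  rewrite -sumd; apply: ler_sum => j _; have zj := small z j ze.
  apply: (le_trans _ zj); rewrite expr2 ler_piMl ?normc_ge0//.
  apply: (le_trans zj); rewrite ler_pdivrMr// mul1r.
  have : (1 <= N%:R :> R)%R by rewrite ler1n.
  by lra.
have subb : box (fun=> 0%R) (fun=> e) `<=` ball.
  by move=> z /gape h; apply/unit_ballE; lra.
exists e, c; split=> //.
  by move=> u /gape ->/=; have := gap_le1 u; lra.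
move=> z w zb wb zw; have := hc 1%R (1 - inner z w)%R ltr01.
rewrite powR1 !mulr1; apply.
rewrite [X in normc X](_ : _ = - inner z w)%R; last by rewrite rmorph1; ring.
rewrite normcN (le_trans (le_normc_sum _))// -sumd; apply: ler_sum => j _.
rewrite normcM normc_conj; case: zw => [ze|we].
  rewrite -[leRHS]mulr1 ler_pM ?normc_ge0//; [exact: small|exact: normc_coord_le1].
rewrite -[leRHS]mul1r ler_pM ?normc_ge0//; [exact: normc_coord_le1|exact: small].
Qed.

(** The test function is the indicator of the central box and the test set is the whole ball. *)
Lemma weight_integrable :
  \int[mu]_(z in ball) (`|omega z| * gap z `^ (t * p + Q))%:E < +oo.
Proof.
have [C C0 hC] := testing_inequality p0 womega bounded_P.
have [e [c [e0 c0 Bb gapB kker]]] := central_box (N%:R + 1 + s + t).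
set B := box _ _ in Bb gapB kker.
have mB : measurable B by exact: measurable_box.
have muB0 : 0 < mu B by exact: muB_box_gt0.
have Woo := weight_mass_lty womega Bb.
pose g : 'rV[R[i]]_N -> R := \1_B.
have mg : measurable_fun ball g by exact: measurable_indic.
have g0 z : ball z -> (0 <= g z)%R by rewrite /g indicE.
have g1 z : B z -> g z = 1%R by move=> Bz; rewrite /g indicE mem_set.
have gN z : ~ B z -> g z = 0%R by move=> Bz; rewrite /g indicE memNset.
have energy_lty : \int[mu]_(z in ball) (g z `^ p * (`|omega z| * gap z `^ q))%:E < +oo.
  rewrite (integral_supported _ Bb); last first.
    by move=> z _ nB; rewrite gN// powR0 ?gt_eqF// mul0r.
  apply: (@le_lt_trans _ _ (\int[mu]_(z in B) ((2 `^ `|q|)%:E * (`|omega z|)%:E))).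
    apply: le_integral_nonmeasurable => z Bz.
      by rewrite lee_fin !mulr_ge0 ?powR_ge0.
    rewrite g1// powR1 mul1r -EFinM lee_fin mulrC ler_wpM2r//.
    by have := @powR_le_comparable R q 1 (gap z); rewrite powR1 !mulr1 mul1r; apply; rewrite ?gapB.
  rewrite ge0_integralZl// ?lte_mul_pinfty ?lee_fin ?powR_ge0//.
  have [mo _ _] := womega; apply/measurable_EFinP; apply: measurableT_comp => //.
  by apply: measurable_funS mo => //; exact: measurable_unit_ball.
have Bfin : mu B \is a fin_num.
  by rewrite ge0_fin_numE// (le_lt_trans _ muB_ball_lty)// le_measure// inE//;
    exact: measurable_unit_ball.
pose m := (2 `^ (- `|s|) * fine (mu B))%R.
have m0 : (0 < m)%R by rewrite mulr_gt0 ?powR_gt0// -lte_fin fineK.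
have mle : m%:E <= \int[mu]_(w in ball) (g w * gap w `^ s)%:E.
  rewrite (integral_supported _ Bb); last by move=> z _ nB; rewrite gN// mul0r.
  rewrite /m EFinM fineK// -integral_cst//.
  apply: le_integral_nonmeasurable => z Bz /=; first by rewrite lee_fin powR_ge0.
  rewrite g1// mul1r lee_fin.
  by have := @powR_ge_comparable R s 1 (gap z); rewrite powR1 !mulr1 mul1r; apply; rewrite ?gapB.
have kk z w : ball z -> ball w -> g w != 0%R ->
    (c <= complex.Re (cpow (1 - inner z w) (N%:R + 1 + s + t))^-1)%R.
  move=> zb wb gw; apply: kker => //; right.
  by apply: contrapT => /gN gw0; rewrite gw0 eqxx in gw.
have := hC g ball c m mg g0 (@measurable_unit_ball R N) (fun _ h => h)
  (ltW c0) (ltW m0) energy_lty kk mle.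
rewrite ltey; apply: contraTneq => ->.
rewrite gt0_muley ?lte_fin ?powR_gt0 ?(mulr_gt0 c0 m0)// leye_eq lt_eqF//.
by rewrite lte_mul_pinfty ?lee_fin.
Qed.

(* As 0 `^ a = 0 for a != 0, psi vanishes on the null set where omega does. *)
Let psi (z : 'rV[R[i]]_N) : R :=
  (`|omega z| `^ (- (p - 1)^-1) * gap z `^ ((s * p - q) / (p - 1)))%R.

Let pp : (0 < p - 1)%R. Proof. by rewrite subr_gt0. Qed.

Lemma measurable_psi : measurable_fun ball psi.
Proof.
have [mo _ _] := womega; apply: measurable_funM; last exact: measurable_gap_powR.
apply: (measurableT_comp (measurable_powR _)).
exact: measurableT_comp.
Qed.

Let psi0 z : (0 <= psi z)%R. Proof. by rewrite mulr_ge0 ?powR_ge0. Qed.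

(* The function psi (1-|z|^2)^(-s), truncated, is extremal in the Hoelder
   inequality for the pairing with (1-|z|^2)^s. *)
Lemma psi_powR z : ball z ->
  ((psi z * gap z `^ (- s)) `^ p * (`|omega z| * gap z `^ q) = psi z)%R.
Proof.
move=> /unit_ballE gz; rewrite /psi.
have [->|o0] := eqVneq (omega z) 0%R.
  by rewrite normr0 powR0 ?oppr_eq0 ?invr_eq0 ?gt_eqF// !mul0r mulr0.
have v0 : (0 < `|omega z|)%R by rewrite normr_gt0.
rewrite -mulrA -powRD ?(gt_eqF gz) ?implybT// powRM ?powR_ge0//.
rewrite -!powRrM mulrACA -{2}[(`|omega z|)%R]powRr1 ?(ltW v0)//.
(* The exponents agree: 1 - p/(p-1) = -1/(p-1) for the weight, and p (s - q)/(p-1) + q = (s p -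
   q)/(p-1) for the gap. *)
rewrite -!powRD ?(gt_eqF gz) ?(gt_eqF v0) ?implybT//.
by congr (_ `^ _ * _ `^ _)%R; field; rewrite gt_eqF.
Qed.

(** For the extremal test function on [E M], the energy and the pairing with h^s are the same number
    J. Testing on the central box gives (c J)^p c2 <= C J, which bounds J independently of the
    truncation. *)
Lemma dual_weight_integrable : \int[mu]_(z in ball) (psi z)%:E < +oo.
Proof.
have [C C0 hC] := testing_inequality p0 womega bounded_P.
have [e [c [e0 c0 Bb gapB kker]]] := central_box (N%:R + 1 + s + t).
set B := box _ _ in Bb gapB kker.
have mB : measurable B by exact: measurable_box.
have mball := @measurable_unit_ball R N.
have muB0 : 0 < mu B by exact: muB_box_gt0.
have W0 := weight_mass_gt0 womega mB Bb muB0.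
have Woo := weight_mass_lty womega Bb.
set W := \int[mu]_(z in B) _ in W0 Woo.
have Wfin : W \is a fin_num by rewrite ge0_fin_numE// ltW.
pose c2 : R := (2 `^ (- `|t * p + Q|) * fine W)%R.
have c20 : (0 < c2)%R by rewrite mulr_gt0 ?powR_gt0// -lte_fin fineK.
have mass_ge : c2%:E <= \int[mu]_(z in B) (`|omega z| * gap z `^ (t * p + Q))%:E.
  rewrite EFinM fineK// -ge0_integralZl//; first last.
  - have [mo _ _] := womega; apply/measurable_EFinP; apply: measurableT_comp => //.
    by apply: measurable_funS mo.
  apply: le_integral_nonmeasurable => z Bz.
    by rewrite -EFinM lee_fin mulr_ge0 ?powR_ge0.
  rewrite -EFinM lee_fin mulrC ler_wpM2l//.
  by have := @powR_ge_comparable R (t * p + Q) 1 (gap z);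
    rewrite powR1 !mulr1 mul1r; apply; rewrite ?gapB.
(* Truncating where [psi] is at most [M] makes J finite beforehand, so that a factor J can be
   divided out. *)
pose E (M : nat) := ball `&` psi @^-1` `]-oo, M%:R].
have mE M : measurable (E M) by apply: measurable_psi.
have Eb M : E M `<=` ball by move=> z [].
pose K := (C / (c `^ p * c2))%R.
have K0 : (0 <= K)%R by rewrite divr_ge0// mulr_ge0 ?powR_ge0// ltW.
have JK M : \int[mu]_(z in E M) (psi z)%:E <= (K `^ (p - 1)^-1)%:E.
  set J := \int[mu]_(z in E M) _.
  have J0 : 0 <= J by apply: integral_ge0 => z _; rewrite lee_fin.
  have Jfin : J \is a fin_num.
    rewrite ge0_fin_numE//.
    apply: (@le_lt_trans _ _ (\int[mu]_(z in E M) (M%:R)%:E)).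
      apply: le_integral_nonmeasurable => z [_ /=]; first by rewrite lee_fin.
      by rewrite in_itv.
    rewrite integral_cst// lte_mul_pinfty ?lee_fin//.
    by apply: le_lt_trans muB_ball_lty; apply: le_measure; rewrite ?inE.
  pose g z := (psi z * gap z `^ (- s) * \1_(E M) z)%R.
  have g1 z : E M z -> g z = (psi z * gap z `^ (- s))%R.
    by move=> Ez; rewrite /g indicE mem_set// mulr1.
  have gN z : ~ E M z -> g z = 0%R by move=> Ez; rewrite /g indicE memNset// mulr0.
  have mg : measurable_fun ball g.
    apply: measurable_funM; last exact: measurable_indic.
    by apply: measurable_funM; [exact: measurable_psi|exact: measurable_gap_powR].
  have g0 z : ball z -> (0 <= g z)%R by rewrite /g indicE !mulr_ge0 ?powR_ge0.
  have energyE : \int[mu]_(z in ball) (g z `^ p * (`|omega z| * gap z `^ q))%:E = J.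
    rewrite (integral_supported _ (Eb M)); last first.
      by move=> z _ nB; rewrite gN// powR0 ?gt_eqF// mul0r.
    by apply: eq_integral => z /set_mem Ez; rewrite g1// psi_powR//; exact: Eb Ez.
  have mE' : \int[mu]_(w in ball) (g w * gap w `^ s)%:E = J.
    rewrite (integral_supported _ (Eb M)); last first.
      by move=> z _ nB; rewrite gN// mul0r.
    apply: eq_integral => z /set_mem Ez; rewrite g1// powRN -mulrA mulVf ?mulr1//.
    by rewrite gt_eqF// powR_gt0//; apply/unit_ballE; exact: Eb Ez.
  have kk z w : B z -> ball w -> g w != 0%R ->
      (c <= complex.Re (cpow (1 - inner z w) (N%:R + 1 + s + t))^-1)%R.
    by move=> zB wb _; apply: kker => //; [exact: Bb|left].
  have energy_lty : \int[mu]_(z in ball) (g z `^ p * (`|omega z| * gap z `^ q))%:E < +oo.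
    by rewrite energyE -ge0_fin_numE.
  have j0 : (0 <= fine J)%R by exact: fine_ge0.
  have := hC g B c (fine J) mg g0 mB Bb (ltW c0) j0 energy_lty kk.
  rewrite fineK// mE' lexx energyE => /(_ isT) key.
  have {key} : ((c * fine J) `^ p * c2 <= C * fine J)%R.
    rewrite -lee_fin [leLHS]EFinM [leRHS]EFinM fineK//; apply: le_trans key.
    by rewrite lee_wpmul2l// lee_fin powR_ge0.
  rewrite -(fineK Jfin) lee_fin; move: j0; set j := fine J => j0 key.
  have [->|jn0] := eqVneq j 0%R; first exact: powR_ge0.
  have jp : (0 < j)%R by rewrite lt_def jn0.
  have -> : j = ((j `^ (p - 1)) `^ (p - 1)^-1)%R.
    by rewrite -powRrM mulfV ?gt_eqF// powRr1.
  apply: ge0_ler_powR; rewrite ?nnegrE ?powR_ge0 ?invr_ge0 ?(ltW pp)//.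
  rewrite powRB ?(gt_eqF jp) ?implybT// powRr1// ler_pdivrMr//.
  rewrite /K mulrAC ler_pdivlMr; last exact: (mulr_gt0 (powR_gt0 p c0) c20).
  by move: key; rewrite powRM ?(ltW c0)//; congr (_ <= _)%R; ring.
(* The truncations exhaust the ball, and monotone convergence carries the uniform bound to the
   limit. *)
have EU : \bigcup_M E M = ball.
  apply/seteqP; split=> [z [M _ []]//|z bz].
  exists (Num.truncn (psi z)).+1 => //; split=> //=.
  by rewrite in_itv/= ltW// truncnS_gt.
have Endec : nondecreasing_seq E.
  move=> M M' MM'; apply/subsetPset => z [bz]; rewrite /= !in_itv/= => zM.
  by split=> //=; rewrite in_itv/= (le_trans zM)// ler_nat.
have mpsi M : measurable_fun (E M) (fun z => (psi z)%:E).
  by apply/measurable_EFinP; apply: measurable_funS measurable_psi.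
have : \int[mu]_(x in E M) (psi x)%:E @[M --> \oo] -->
    \int[mu]_(x in \bigcup_M E M) (psi x)%:E.
  by apply: ge0_nondecreasing_set_cvg_integral => // M z _; rewrite lee_fin.
rewrite EU => /cvg_lim <-//.
apply: (@le_lt_trans _ _ (K `^ (p - 1)^-1)%:E); last exact: ltry.
apply: lime_le; last by apply: nearW => M; exact: JK.
apply: ereal_nondecreasing_is_cvgn.
by apply: ge0_nondecreasing_set_nondecreasing_integral => // M z _; rewrite lee_fin.
Qed.

(** The sum of the two integrable functions dominates h^(-1) by Young's inequality, which
    contradicts [integral_inv_gap]. *)
Lemma critical_exponent : (-1 < s + t + (Q - q) / p)%R.
Proof.
rewrite ltNge; apply/negP => b1.
have [Z [mZ Z0 oZ]] := weight_ae_pos womega.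
have mball := @measurable_unit_ball R N.
have mv : measurable_fun ball (fun z => (`|omega z| * gap z `^ (t * p + Q))%:E).
  by apply/measurable_EFinP; exact: measurable_weight_gap.
have mpsi : measurable_fun ball (fun z => (psi z)%:E).
  by apply/measurable_EFinP; exact: measurable_psi.
suff : +oo <= \int[mu]_(z in ball) ((`|omega z| * gap z `^ (t * p + Q))%:E +
    (psi z)%:E).
  rewrite ge0_integralD//; first last.
  - by move=> z _; rewrite lee_fin.
  - by move=> z _; rewrite lee_fin mulr_ge0 ?powR_ge0.
  by rewrite leye_eq lt_eqF// lte_add_pinfty//;
    [exact: weight_integrable|exact: dual_weight_integrable].
apply: (@le_trans _ _ (\int[mu]_(z in ball) (gap z `^ (-1))%:E)).
  by rewrite integral_inv_gap.
apply: (le_integral_off_null mball mZ Z0).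
- by apply/measurable_EFinP; exact: measurable_gap_powR.
- by move=> z _; rewrite lee_fin powR_ge0.
move=> z bz nZ; have gz : (0 < gap z)%R by apply/unit_ballE.
have v0 : (0 < `|omega z|)%R by rewrite normr_gt0 gt_eqF// oZ.
rewrite -EFinD lee_fin.
(* As 0 < gap <= 1, an exponent at most -1 gives a power at least gap^(-1). *)
apply: (@le_trans _ _ (gap z `^ (s + t + (Q - q) / p))%R).
  by apply: ger_powR => //; rewrite gz gap_le1.
(* The factors are chosen so that the weight cancels in x y, while x^p and y^(p/(p-1)) are the two
   integrable functions. *)
pose x := (`|omega z| `^ p^-1 * gap z `^ (t + Q / p))%R.
pose y := (`|omega z| `^ (- p^-1) * gap z `^ (s - q / p))%R.
have -> : (gap z `^ (s + t + (Q - q) / p) = x * y)%R.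
  rewrite /x /y mulrACA -!powRD ?(gt_eqF gz) ?(gt_eqF v0) ?implybT// subrr powRr0 mul1r.
  by congr (_ `^ _)%R; ring.
have x0 : (0 <= x)%R by rewrite mulr_ge0 ?powR_ge0.
have y0 : (0 <= y)%R by rewrite mulr_ge0 ?powR_ge0.
have pq0 : (0 < p / (p - 1))%R by rewrite divr_gt0.
have := conjugate_powR x0 y0 p0 pq0.
have -> : (p^-1 + (p / (p - 1))^-1 = 1)%R by field; rewrite !gt_eqF.
move=> /(_ erefl)/le_trans; apply.
have -> : (x `^ p = `|omega z| * gap z `^ (t * p + Q))%R.
  rewrite /x powRM ?powR_ge0// -!powRrM mulVf ?gt_eqF// powRr1//.
  by congr (_ * _ `^ _)%R; field; rewrite gt_eqF.
have -> : (y `^ (p / (p - 1)) = psi z)%R.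
  rewrite /y powRM ?powR_ge0// -!powRrM.
  by congr (_ `^ _ * _ `^ _)%R; field; rewrite !gt_eqF.
(* The factors 1/p and (p - 1)/p of Young's inequality are at most 1 and are dropped. *)
apply: lerD.
  by rewrite ler_pdivrMr// ler_peMr ?mulr_ge0 ?powR_ge0// ltW.
by rewrite ler_pdivrMr// ler_peMr// ler_pdivlMr// mul1r gerBl.
Qed.

End integrability.

Theorem theorem1p10 (R : realType) (N : nat) (p q Q s t : R) :
  (1 <= N)%N -> 1 < p -> -1 < s ->
  (- (N%:R + 1) < s + t /\ s + t < -1 /\ s + t + (Q - q) / p <= -1) \/
  (-1 < s + t /\ Q < q) ->
  ~ exists omega : 'rV[R[i]]_N -> R,
      weight omega /\ well_defined_continuous s t p q Q omega.
Proof.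
case: N => // n _ p1 _ [[_ [_ b1]]|[_ Qq]] [omega [womega bounded_P]].
  by have := critical_exponent p1 womega bounded_P; rewrite ltNge b1.
have := no_gain (lt_trans ltr01 p1) womega bounded_P.
by rewrite leNgt Qq.
Qed.
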